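(* Let $d,n$ be integers with $1\le d<n$. Then $$f(0,n-d,n)\ge\binom{n}{d}2^n\left(\frac{1}{\pi}\arctan\frac{1}{\sqrt{n-d}}\right)^d.$$ Equality holds for $d=1$, that is, $$f(0,n-1,n)=\frac{2^n n}{\pi}\arctan\frac{1}{\sqrt{n-1}}.$$
   Context: $G_{n,k}$ is the set of $k$-dimensional linear subspaces of $\mathbb{R}^n$ with its normalized rotation-invariant probability measure (the image of normalized Haar measure on the orthogonal group $O(n)$ under $g\mapsto g(\mathrm{span}(e_1,\dots,e_k))$, where $e_1,\dots,e_n$ is the standard basis). For integers $0\le j<k<n$, $f(j,k,n)$ denotes the expected number of $j$-dimensional faces of the polytope $X\cap[-1,1]^n$, where $X$ is random in $G_{n,k}$ according to this measure; in particular $f(0,k,n)$ is the expected number of vertices. *)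

(* Defs.v *)
From HB Require Import structures.
From mathcomp Require Import all_boot all_order all_algebra.
From mathcomp Require Import all_classical all_reals all_analysis.
Set Implicit Arguments.
Unset Strict Implicit.
Unset Printing Implicit Defensive.
Import Order.TTheory GRing.Theory Num.Theory.
Import numFieldNormedType.Exports.
Local Open Scope classical_set_scope.
Local Open Scope ring_scope.

Definition orthogonal_group (R : realType) (n : nat) : set 'M[R]_n :=
  [set g | g^T *m g = 1%:M].
Arguments orthogonal_group : clear implicits.

Notation borel_matrix R n := (g_sigma_algebraType (@open 'M[R]_n)).

(* A Borel measure on the closed subset O(n) is represented by the
   corresponding Borel measure on n x n matrices concentrated on O(n).  The two
   conditions below characterize normalized Haar measure uniquely. *)
Definition normalized_haar (R : realType) (n : nat)
    (mu : probability (borel_matrix R n) R) : Prop :=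
  mu (orthogonal_group R n) = 1%E /\
  forall g : 'M[R]_n, orthogonal_group R n g ->
    forall A : set (borel_matrix R n), measurable A ->
      mu [set g *m h | h in A] = mu A.

Definition std_subspace (R : realType) (n k : nat) : {vspace 'cV[R]_n} :=
  <<[seq (delta_mx i 0)%R : 'cV[R]_n | i : 'I_n <- enum 'I_n & (i < k)%N]>>%VS.
Arguments std_subspace : clear implicits.

Definition mx_image (R : realType) (n : nat) (g : 'M[R]_n)
    (X : {vspace 'cV[R]_n}) : {vspace 'cV[R]_n} :=
  (linfun (mulmx g : 'cV[R]_n -> 'cV[R]_n) @: X)%VS.

(* The carrier consists of all linear subspaces of R^n, so that it is nonempty
   for every k; [grassmann_measure] below is carried by those of dimension k
   (see [dim_rotated_std_subspace]).  A set of subspaces is measurable when its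
   preimage under g |-> g (span (e_1, ..., e_k)) is Borel. *)
Definition grassmann_space (R : realType) (n k : nat) : Type :=
  {vspace 'cV[R]_n}.

Definition rotated_std_subspace (R : realType) (n k : nat)
    (g : borel_matrix R n) : grassmann_space R n k :=
  mx_image g (std_subspace R n k).
Arguments rotated_std_subspace : clear implicits.

Section GrassmannMeasurable.
Variables (R : realType) (n k : nat).

Let rot := rotated_std_subspace R n k.

Let gr_measurable : set (set (grassmann_space R n k)) :=
  [set B | measurable (rot @^-1` B)].

Let gr_measurable0 : gr_measurable set0.
Proof. by rewrite /gr_measurable /= preimage_set0; exact: measurable0. Qed.

Let gr_measurableC B : gr_measurable B -> gr_measurable (~` B).
Proof.
by rewrite /gr_measurable /= => mB; rewrite preimage_setC; exact: measurableC.
Qed.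

Let gr_measurable_bigcup (F : (set (grassmann_space R n k))^nat) :
  (forall i, gr_measurable (F i)) -> gr_measurable (\bigcup_i F i).
Proof.
rewrite /gr_measurable /= => mF; rewrite preimage_bigcup.
by apply: bigcupT_measurable => i; exact: mF.
Qed.

HB.instance Definition _ := Choice.copy (grassmann_space R n k)
  {vspace 'cV[R]_n}.
HB.instance Definition _ := isPointed.Build (grassmann_space R n k)
  (std_subspace R n k).
HB.instance Definition _ := @isMeasurable.Build default_measure_display
  (grassmann_space R n k) gr_measurable gr_measurable0 gr_measurableC
  gr_measurable_bigcup.

End GrassmannMeasurable.

Definition grassmann_measure (R : realType) (n : nat)
    (mu : probability (borel_matrix R n) R) (k : nat) :
    set (grassmann_space R n k) -> \bar R :=
  pushforward mu (rotated_std_subspace R n k).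
Arguments grassmann_measure {R n} mu k.

Lemma dim_rotated_std_subspace (R : realType) (n k : nat) (g : 'M[R]_n) :
  orthogonal_group R n g -> (k <= n)%N ->
  \dim (rotated_std_subspace R n k g : {vspace 'cV[R]_n}) = k.
Proof.
move=> gO kn; rewrite /rotated_std_subspace /mx_image limg_dim_eq; last first.
  apply/eqP; rewrite -subv0; apply/subvP => v; rewrite memv_cap memv_ker lfunE /=.
  case/andP=> _ /eqP gv0; rewrite memv0; apply/eqP.
  by rewrite -(mul1mx v) -gO -mulmxA gv0 mulmx0.
rewrite /std_subspace; set s := [seq _ | i <- _ & _].
have ss : size s = k.
  rewrite size_map size_filter -sum1_count big_enum_cond /=.
  rewrite -(big_ord_widen_cond n xpredT (fun=> 1%N) kn) sum1_card card_ord //.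
have us : uniq s.
  rewrite map_inj_uniq; first by apply: filter_uniq; exact: enum_uniq.
  move=> i j /matrixP /(_ i 0); rewrite !mxE !eqxx /= andbT.
  by case: eqP => // _ /eqP; rewrite oner_eq0.
have fs : free s.
  apply/(@freeP _ _ _ (in_tuple s)) => c /= c0 i.
  have sE (j : 'I_(size s)) : exists l : 'I_n, s`_j = delta_mx l 0.
    have /mapP[l _ ->] : s`_j \in s by rewrite mem_nth.
    by exists l.
  have [l sl] := sE i.
  move/matrixP/(_ l 0): c0; rewrite summxE (bigD1 i) //= !mxE sl !mxE !eqxx.
  rewrite mulr1 big1 ?addr0// => j ji; rewrite !mxE.
  have [m sm] := sE j; rewrite sm !mxE eqxx andbT.
  case: eqP => [lm|]; last by rewrite mulr0.
  have /eqP : s`_i = s`_j by rewrite sl sm lm.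
  by rewrite nth_uniq// => /eqP/ord_inj ij; rewrite ij eqxx in ji.
by move: fs; rewrite /free => /eqP ->; rewrite ss.
Qed.

Definition cube (R : realType) (n : nat) : set 'cV[R]_n :=
  [set x | forall i, `|x i 0| <= 1].
Arguments cube : clear implicits.

Definition dot (R : realType) (n : nat) (a x : 'cV[R]_n) : R :=
  \sum_(i < n) a i 0 * x i 0.

(* Intersection with a supporting hyperplane; a = 0 gives the improper faces. *)
Definition is_face (R : realType) (n : nat) (P F : set 'cV[R]_n) : Prop :=
  exists (a : 'cV[R]_n) (b : R),
    (forall x, P x -> dot a x <= b) /\ F = [set x | P x /\ dot a x = b].

(* F is nonempty and j is the dimension of its affine hull, i.e. of the smallest
   linear subspace containing all the differences of points of F. *)
Definition has_affine_dim (R : realType) (n j : nat) (F : set 'cV[R]_n) : Prop :=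
  F !=set0 /\
  exists V : {vspace 'cV[R]_n},
    [/\ \dim V = j,
        forall x y, F x -> F y -> x - y \in V &
        forall W : {vspace 'cV[R]_n},
          (forall x y, F x -> F y -> x - y \in W) -> (V <= W)%VS].

Definition faces (R : realType) (n j : nat) (P : set 'cV[R]_n) :
    set (set 'cV[R]_n) :=
  [set F | is_face P F /\ has_affine_dim j F].

Definition cube_section (R : realType) (n : nat) (X : {vspace 'cV[R]_n}) :
    set 'cV[R]_n :=
  [set x | x \in X] `&` cube R n.

(* f(j, k, n), the dimension n being determined by the type of mu. *)
Definition expected_faces (R : realType) (n : nat)
    (mu : probability (borel_matrix R n) R) (j k : nat) : \bar R :=
  (\int[grassmann_measure mu k]_X
     counting (faces j (cube_section (X : {vspace 'cV[R]_n}))))%E.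

(* Main.v *)
From HB Require Import structures.
Require Import Defs.
From mathcomp Require Import all_boot all_order all_algebra.
From mathcomp Require Import fingroup perm.
From mathcomp Require Import all_classical all_reals all_analysis.
From mathcomp Require Import measurable_realfun.
From mathcomp Require Import ring lra.
Set Implicit Arguments.
Unset Strict Implicit.
Unset Printing Implicit Defensive.
Import Order.TTheory GRing.Theory Num.Theory.
Import numFieldNormedType.Exports.
Local Open Scope classical_set_scope.
Local Open Scope ring_scope.

(** Let [k = n - d] and let [X] be the random subspace, spanned by the first [k] columns
    of a Haar matrix [g].  Almost surely [X] is transversal to all the coordinate
    subspaces of dimension [d].  The vertices of the section of the cube by [X] are then
    the points where [X] meets the [d]-dimensional faces of the cube.  There are
    ['C(n, d) * 2 ^ k] such faces, exchanged by the symmetries of the cube, which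
    preserve the law of [X]; so the expected number of vertices is this number times the
    probability [p] that [X] meets the face whose first [k] coordinates are [1].

    To compute [p], let [L] be the [(d+1)]-dimensional space of the vectors whose first
    [k] coordinates are equal; it contains the face.  The line in which [X] meets [L] is
    invariant in law under the orthogonal group of [L], hence it has the law of the line
    spanned by a standard Gaussian vector [(w, z_1, ..., z_d)] of [L], where [w] is the
    coordinate along the unit vector [(1, ..., 1, 0, ..., 0) / sqrt k].  The line meets
    the face exactly when [|z_i| <= t * |w|] for all [i], with [t = 1 / sqrt k].
    Conditionally on [w] the [z_i] are independent, so [p] is the mean of the [d]-th
    power of [P (|z| <= t * |w| given w)].  By Jensen's inequality [p] is at least the
    [d]-th power of [P (|z| <= t * |w|)], with equality for [d = 1]; and since [z / w]
    has the Cauchy law this probability is [2 / pi * atan t].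

    The identification of the two laws of lines is the heart of the matter.  It is
    replaced by a comparison of the probabilities of cones, [isotropic_cone_le]: two
    independent isotropic vectors are equally often close to each other, whichever of
    them is integrated first.  Isotropy holds for Gaussian vectors by rotation
    invariance of the planar Gaussian law ([gaussT_law]), and for the random line by
    reflections in [O(n)] that preserve [L] ([slice_dir_isotropic]).  General position
    ([minor_null]) also comes from reflections: an event of positive measure cannot have
    infinitely many disjoint images of the same measure.

    The number of vertices is bounded from below everywhere by the number of relatively
    open faces that [X] meets transversally ([count_vertices_ge]), and from above off a
    null set by the number of closed faces that it meets ([count_vertices_le]). *)

(** * Affine substitutions in Lebesgue integrals *)

Section affine.
Context {R : realType}.
Local Notation lambda := (@lebesgue_measure R).

Let affine (a b : R) : measurableTypeR R -> measurableTypeR R :=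
  fun x => a * x + b.

Lemma measurable_affine (a b : R) : measurable_fun setT (fun x : measurableTypeR R => (a * x + b : measurableTypeR R)).
Proof.
by apply: measurable_funD => //; apply: measurable_funM.
Qed.

(** Lebesgue measure is determined by its values on half-open intervals, whose preimages
    under [x |-> a * x + b] are intervals of length divided by [|a|]. *)
Lemma lebesgue_measure_affine (a b : R) (A : set (measurableTypeR R)) :
  a != 0 -> measurable A ->
  (`|a|%:E * lambda ((fun x => a * x + b)%R @^-1` A) = lambda A)%E.
Proof.
move=> a0 mA.
have mf := measurable_affine a b.
pose nu' := mscale (NngNum (normr_ge0 a)) (pushforward lambda (affine a b)).
have -> : lambda A = nu' mf A.
  apply: lebesgue_measure_unique => //= _ [[u v]] _ <- /=.
  rewrite /nu' /mscale/= /pushforward/=.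
  rewrite lebesgue_measure_itv/= lte_fin.
  have [ap|] := ltrP 0 a; last rewrite le_eqVlt (negbTE a0)/= => an.
    rewrite (_ : _ @^-1` _ = `](u - b) / a, (v - b) / a]%classic); last first.
      apply/seteqP; split => x /=; rewrite !in_itv/= /affine ltr_pdivrMr// ler_pdivlMr//.
        by rewrite ltrBlDr lerBrDr ![x * a]mulrC.
      by rewrite ltrBlDr lerBrDr ![x * a]mulrC.
    rewrite lebesgue_measure_itv/= lte_fin ltr_pM2r ?invr_gt0// ltrD2r.
    case: ifP => _; last by rewrite mule0.
    by rewrite -EFinM gtr0_norm//; congr EFin; field; rewrite gt_eqF.
  rewrite (_ : _ @^-1` _ = `[(v - b) / a, (u - b) / a[%classic); last first.
    apply/seteqP; split => x /=; rewrite !in_itv/= /affine ler_ndivrMr// ltr_ndivlMr//.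
      by rewrite ltrBlDr lerBrDr ![x * a]mulrC andbC.
    by rewrite ltrBlDr lerBrDr ![x * a]mulrC andbC.
  rewrite lebesgue_measure_itv/= lte_fin ltr_nM2r ?invr_lt0// ltrD2r.
  case: ifP => _; last by rewrite mule0.
  by rewrite -EFinM ltr0_norm//; congr EFin; field; rewrite lt_eqF.
by rewrite /nu' /mscale /pushforward.
Qed.

Lemma ge0_integral_affine (a b : R) (f : R -> \bar R) :
  a != 0 -> measurable_fun setT f -> (forall x, (0 <= f x)%E) ->
  (`|a|%:E * \int[lambda]_x f (a * x + b)%R = \int[lambda]_x f x)%E.
Proof.
move=> a0 mf f0.
have ma := measurable_affine a b.
pose nu' := mscale (NngNum (normr_ge0 a)) (pushforward lambda (affine a b)).
transitivity (\int[nu' ma]_x f x)%E; last first.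
  apply: eq_measure_integral => A mA _.
  exact: (lebesgue_measure_affine b a0 mA).
rewrite ge0_integral_mscale//=; congr *%E.
by rewrite ge0_integral_pushforward.
Qed.

End affine.

(** * The standard Gaussian law on the line *)

Section gaussian.
Context {R : realType}.
Local Notation lambda := (@lebesgue_measure R).

Definition gauss : probability (measurableTypeR R) R := normal_prob 0 1.

Definition gauss_pdf (x : R) : R := normal_pdf 0 1 x.

Lemma gauss_pdfE x : gauss_pdf x = normal_peak 1 * expR (- (x ^+ 2 / 2)).
Proof.
rewrite /gauss_pdf normal_pdfE ?oner_eq0// /normal_fun subr0.
by rewrite expr1n mulNr.
Qed.

Lemma gauss_pdf_gt0 x : 0 < gauss_pdf x.
Proof. by rewrite gauss_pdfE mulr_gt0 ?expR_gt0 ?normal_peak_gt0 ?oner_neq0. Qed.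

Lemma gauss_pdf_sqD (x y z t : R) : x ^+ 2 + y ^+ 2 = z ^+ 2 + t ^+ 2 ->
  gauss_pdf x * gauss_pdf y = gauss_pdf z * gauss_pdf t.
Proof.
move=> xyzt; rewrite !gauss_pdfE mulrACA [RHS]mulrACA -!expRD; congr (_ * expR _).
by rewrite -!opprD -!mulrDl xyzt.
Qed.

Lemma measurable_gauss_pdf : measurable_fun [set: measurableTypeR R] gauss_pdf.
Proof. exact: measurable_normal_pdf. Qed.

Lemma gaussE (A : set (measurableTypeR R)) :
  gauss A = (\int[lambda]_(x in A) (gauss_pdf x)%:E)%E.
Proof. by []. Qed.

(** The Gaussian law has density [gauss_pdf], which is therefore its Radon-Nikodym
    derivative almost everywhere. The bound on [f] makes it integrable; all the
    integrands below are probabilities. *)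
Lemma integral_gauss (f : measurableTypeR R -> \bar R) :
  measurable_fun setT f -> (forall x, 0 <= f x <= 1)%E ->
  (\int[gauss]_x f x = \int[lambda]_x (f x * (gauss_pdf x)%:E))%E.
Proof.
move=> mf f01.
have gl := normal_prob_dominates (0:R) 1.
rewrite -(Radon_Nikodym_change_of_variables gl)//=; last first.
  apply/integrableP; split => //.
  apply: (@le_lt_trans _ _ (\int[gauss]_x cst 1 x)%E).
    apply: ge0_le_integral => //=.
    - exact: measurableT_comp.
    - by move=> x _; have /andP[? ?] := f01 x; rewrite gee0_abs.
  by rewrite integral_cst//= mul1e (@probability_setT _ _ _ gauss) ltry.
apply: ae_eq_integral => //.
- by apply: emeasurable_funM => //; apply: (measurable_int lambda).
- apply: emeasurable_funM => //; apply/measurable_EFinP.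
  exact: measurable_gauss_pdf.
- apply: ae_eqe_mul2l => /=.
  rewrite Radon_NikodymE//=.
  case: (cid _) => /= h [h1 h2 h3].
  apply: integral_ae_eq => //=.
  + by apply/measurable_EFinP; exact: measurable_gauss_pdf.
  + by move=> E E01 mE; rewrite -h3.
Qed.

(** A positive density integrates to [0] only over a null set, and [`]c, c + 1[] is not
    null. *)
Lemma gauss_tail_gt0 (c : R) : (0 < gauss [set x | c < x]%R)%E.
Proof.
rewrite lt0e measure_ge0 andbT; apply/eqP => g0.
have mA : measurable [set x : measurableTypeR R | c < x].
  rewrite (_ : [set x | _] = `]c, +oo[%classic); first exact: measurable_itv.
  by apply/seteqP; split => x /=; rewrite in_itv/= andbT.
have : (\int[lambda]_(x in [set x | c < x]%R) `|(gauss_pdf x)%:E| = 0)%E.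
  rewrite -[RHS]g0 gaussE; apply: eq_integral => x _.
  by rewrite gee0_abs// lee_fin ltW// gauss_pdf_gt0.
move/ae_eq_integral_abs => /(_ mA).
case=> [|N [mN N0 sub]].
  by apply: measurable_funTS; apply/measurable_EFinP; exact: measurable_gauss_pdf.
have : (lambda (`]c, (c + 1)%R[%classic : set R) <= lambda N)%E.
  apply: le_measure; rewrite ?inE//.
  move=> x/=; rewrite in_itv/= => /andP[cx _]; apply: sub => /= /(_ cx)[].
  by apply/eqP; rewrite gt_eqF// gauss_pdf_gt0.
by rewrite N0 lebesgue_measure_itv/= lte_fin ltrDl ltr01 -EFinB addrAC subrr add0r lee_fin ler10.
Qed.

End gaussian.

(** * Rotation invariance of the planar Gaussian law *)

Section rotation.
Context {R : realType}.
Local Notation lambda := (@lebesgue_measure R).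
Local Notation plane := (measurableTypeR R * measurableTypeR R)%type.

Definition plane_rot (a b : R) (p : plane) : plane :=
  (a * p.1 + b * p.2, - b * p.1 + a * p.2).

Lemma measurable_plane_rot (a b : R) : measurable_fun setT (plane_rot a b).
Proof.
apply: measurable_fun_pair => /=.
  by apply: measurable_funD; apply: measurable_funM.
by apply: measurable_funD; apply: measurable_funM.
Qed.

(** Tonelli reduces the rotation to two affine substitutions of the line: first
    [x |-> a * x + b * y] at fixed [y], then [y |-> a^-1 * y - (b / a) * x] at fixed
    [x]. Their factors [|a|^-1] and [|a|] cancel. The case [a = 0], a quarter turn,
    escapes this factorization. *)
Lemma lebesgue_plane_rot (a b : R) (F : plane -> \bar R) :
  a != 0 -> a ^+ 2 + b ^+ 2 = 1 ->
  measurable_fun setT F -> (forall p, 0 <= F p)%E ->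
  (\int[lambda]_y \int[lambda]_x F (plane_rot a b (x, y)) =
   \int[lambda]_x \int[lambda]_y F (x, y))%E.
Proof.
move=> a0 ab mF F0.
have mG : measurable_fun setT (fun p : plane => F (p.1, (a^-1 * p.2 + - (b / a) * p.1)%R)).
  apply: measurableT_comp => //; apply: measurable_fun_pair => //=.
  by apply: measurable_funD; apply: measurable_funM.
transitivity (\int[lambda]_y (`|a|^-1%:E * \int[lambda]_x F (x, (a^-1 * y + - (b / a) * x)%R)))%E.
  apply: eq_integral => y _.
  rewrite -(@ge0_integral_affine _ a (b * y) (fun x => F (x, (a^-1 * y + - (b / a) * x)%R))) //.
    rewrite muleA -EFinM mulVf ?normr_eq0// mul1e; apply: eq_integral => x _.
    congr F; congr pair => /=.
    apply: (mulfI a0); transitivity ((1 - b ^+ 2) * y - a * b * x).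
      by rewrite -ab; ring.
    by field.
  exact: (measurableT_comp mG (pair2_measurable y)).
rewrite ge0_integralZl//; last 2 first.
- by apply: (measurable_fun_fubini_tonelli_G (m1:=lambda) _ mG).
- by move=> y _; exact: integral_ge0.
rewrite -(fubini_tonelli (m1:=lambda) (m2:=lambda) _ mG)//=.
rewrite -ge0_integralZl//; last 2 first.
- by apply: (measurable_fun_fubini_tonelli_F (m2:=lambda) _ mG).
- by move=> y _; exact: integral_ge0.
apply: eq_integral => x _.
rewrite -(@ge0_integral_affine _ a^-1 (- (b / a) * x) (fun y => F (x, y))) ?invr_eq0//.
  by rewrite normfV.
exact: (measurableT_comp mF (pair1_measurable x)).
Qed.

Lemma gauss2E (E : set plane) : measurable E ->
  ((gauss \x gauss) E = \int[lambda]_x \int[lambda]_y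
    (\1_E (x, y) * (gauss_pdf x * gauss_pdf y))%:E)%E.
Proof.
move=> mE; rewrite /product_measure1/=.
rewrite integral_gauss//; last 2 first.
- exact: measurable_fun_xsection.
- by move=> x; rewrite measure_ge0 probability_le1//; exact: measurable_xsection.
apply: eq_integral => x _ /=; rewrite gaussE muleC integral_mkcond.
rewrite -ge0_integralZl//; last 3 first.
- apply/(measurable_restrictT _ _).1; first exact: measurable_xsection.
  apply/measurable_funTS/measurable_EFinP; exact: measurable_gauss_pdf.
- by move=> y _; apply: erestrict_ge0 => z _; rewrite lee_fin ltW// gauss_pdf_gt0.
- by rewrite lee_fin ltW// gauss_pdf_gt0.
apply: eq_integral => y _; rewrite patchE indicE mem_xsection.
by case: ifPn => _; rewrite ?mul1r ?mul0r ?mule0// EFinM.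
Qed.

(** The product density depends on [x ^+ 2 + y ^+ 2] only, so that invariance of the
    Gaussian law follows from that of Lebesgue measure. *)
Lemma gauss_plane_rot_neq0 (a b : R) (E : set plane) :
  a != 0 -> a ^+ 2 + b ^+ 2 = 1 -> measurable E ->
  (gauss \x gauss)%E (plane_rot a b @^-1` E) = (gauss \x gauss)%E E.
Proof.
move=> a0 ab mE.
have mrE : measurable (plane_rot a b @^-1` E).
  by rewrite -[X in measurable X]setTI; exact: measurable_plane_rot.
pose F (p : plane) := (\1_E p * (gauss_pdf p.1 * gauss_pdf p.2))%:E.
have mF : measurable_fun setT F.
  apply/measurable_EFinP; apply: measurable_funM; first exact: measurable_indic.
  by apply: measurable_funM; apply: measurableT_comp => //; exact: measurable_gauss_pdf.
have F0 p : (0 <= F p)%E.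
  by rewrite lee_fin mulr_ge0// mulr_ge0// ltW// gauss_pdf_gt0.
rewrite (gauss2E mrE) (gauss2E mE).
transitivity (\int[lambda]_x \int[lambda]_y (F \o plane_rot a b) (x, y))%E.
  apply: eq_integral => x _; apply: eq_integral => y _.
  rewrite /F/=; congr (_ * _)%:E.
  by apply: gauss_pdf_sqD; rewrite -[LHS]mul1r -ab; ring.
have mFr := measurableT_comp mF (measurable_plane_rot a b).
have F0r p : (0 <= (F \o plane_rot a b) p)%E by exact: F0.
transitivity (\int[lambda]_y \int[lambda]_x (F \o plane_rot a b) (x, y))%E.
  exact: (fubini_tonelli (m1:=lambda) (m2:=lambda) _ mFr F0r).
transitivity (\int[lambda]_x \int[lambda]_y F (x, y))%E.
  exact: (lebesgue_plane_rot a0 ab mF F0).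
by [].
Qed.

Lemma gauss_plane_rot (a b : R) (E : set plane) :
  a ^+ 2 + b ^+ 2 = 1 -> measurable E ->
  (gauss \x gauss)%E (plane_rot a b @^-1` E) = (gauss \x gauss)%E E.
Proof.
move=> ab mE; have [a0|a0] := eqVneq a 0; last exact: gauss_plane_rot_neq0.
have b2 : b ^+ 2 = 1 by rewrite -ab a0 expr0n add0r.
have b0 : b != 0 by apply: contra_eq_neq b2 => ->; rewrite expr0n eq_sym oner_neq0.
(* A quarter turn is the composite of two rotations with nonzero cosine; the Pythagorean
   triple 3, 4, 5 provides one of them with rational entries. *)
pose c : R := 3 / 5; pose s : R := 4 / 5.
have cs : c ^+ 2 + s ^+ 2 = 1 by rewrite /c /s; field.
have mcE : measurable (plane_rot c s @^-1` E).
  by rewrite -[X in measurable X]setTI; exact: measurable_plane_rot.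
have c0 : c != 0 by rewrite /c; lra.
have -> : plane_rot a b @^-1` E =
    plane_rot (s * b) (c * b) @^-1` (plane_rot c s @^-1` E).
  apply/seteqP; split=> [] [x y] /=; rewrite /plane_rot /= a0.
    by congr E; congr pair; rewrite /c /s; field.
  by congr E; congr pair; rewrite /c /s; field.
rewrite !gauss_plane_rot_neq0//.
by rewrite mulf_neq0// /s; lra.
by rewrite -[RHS]cs /s /c !exprMn b2 !mulr1 addrC.
Qed.

End rotation.

(** * Measurability, product probabilities and Gaussian vectors *)

Definition vdot {R : realType} m (x y : 'I_m -> R) : R := \sum_(i < m) x i * y i.

Lemma vdot_ge0 {R : realType} m (x : 'I_m -> R) : 0 <= vdot x x.
Proof. by apply: sumr_ge0 => i _; rewrite -expr2 sqr_ge0. Qed.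

Lemma mem_setb T (b : pred T) t : (t \in [set t | b t]) = b t.
Proof. by apply/idP/idP; rewrite inE. Qed.

Section measurable_sets.
Context {R : realType} d (T : measurableType d).

Lemma measurable_set_bool (b : T -> bool) :
  measurable_fun setT b -> measurable [set t | b t].
Proof. by move=> mb; have := mb measurableT [set true]; rewrite setTI; apply. Qed.

Lemma measurable_set_ltr (f g : T -> R) :
  measurable_fun setT f -> measurable_fun setT g -> measurable [set t | f t < g t].
Proof. by move=> mf mg; apply/measurable_set_bool/measurable_fun_ltr. Qed.

End measurable_sets.

Section prod_probability.
Context {R : realType} d1 d2 (T1 : measurableType d1) (T2 : measurableType d2).
Variables (P : probability T1 R) (Q : probability T2 R).

(** A name of its own for the product, so that it can carry the structure of a
    probability. *)
Definition prod_prob : set (T1 * T2) -> \bar R := (P \x Q)%E.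

HB.instance Definition _ := Measure.on prod_prob.

Let prod_probT : prod_prob [set: _] = 1%:E.
Proof.
rewrite /prod_prob -setXTT product_measure1E//.
by rewrite -[RHS]mule1; congr *%E; exact: probability_setT.
Qed.

HB.instance Definition _ := Measure_isProbability.Build _ _ _ prod_prob prod_probT.

Lemma prod_probE (E : set (T1 * T2)) :
  (prod_prob E = \int[P]_x Q [set y | E (x, y)])%E.
Proof.
apply: eq_integral => x _; congr (Q _).
by apply/seteqP; split => y; rewrite /xsection /= ?inE.
Qed.

Lemma prod_probEr (E : set (T1 * T2)) : measurable E ->
  (prod_prob E = \int[Q]_y P [set x | E (x, y)])%E.
Proof.
move=> mE; have := indic_fubini_tonelli P Q mE.
rewrite (indic_fubini_tonelli_FE Q mE) (indic_fubini_tonelli_GE P mE) => H.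
transitivity (\int[P]_x (Q \o xsection E) x)%E; first by [].
rewrite H; apply: eq_integral => y _ /=; congr (P _).
by apply/seteqP; split => x; rewrite /ysection /= ?inE.
Qed.

Lemma measurable_prod_prob_section (E : set (T1 * T2)) : measurable E ->
  measurable_fun setT (fun x => Q [set y | E (x, y)]).
Proof.
move=> mE; rewrite (_ : (fun _ => _) = Q \o xsection E).
  exact: measurable_fun_xsection.
apply/funext => x /=; congr (Q _).
by apply/seteqP; split => y; rewrite /xsection /= ?inE.
Qed.

Lemma ge0_integral_prod_prob (f : T1 * T2 -> \bar R) :
  measurable_fun setT f -> (forall p, 0 <= f p)%E ->
  (\int[prod_prob]_p f p = \int[P]_x \int[Q]_y f (x, y))%E.
Proof. by move=> mf f0; rewrite /prod_prob; apply: (fubini_tonelli1 _ mf f0). Qed.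

End prod_probability.

Section gaussT.
Context {R : realType}.
Local Notation RM := (measurableTypeR R).

Definition cons_pair m (p : RM * m.-tuple RM) : m.+1.-tuple RM := cons_tuple p.1 p.2.

Lemma measurable_cons_pair m : measurable_fun setT (@cons_pair m).
Proof. exact: measurable_cons. Qed.

HB.instance Definition _ m := isMeasurableFun.Build _ _ _ _ (@cons_pair m) (@measurable_cons_pair m).

(** The law of [m] independent standard Gaussian variables, obtained by adding one
    coordinate at a time at the head of the tuple. *)
Fixpoint gaussT m : probability (m.-tuple RM) R :=
  if m is m'.+1 then distribution (prod_prob gauss (gaussT m')) (@cons_pair m')
  else dirac ([tuple] : 0.-tuple RM).

Lemma gaussTS m (A : set (m.+1.-tuple RM)) :
  (gaussT m.+1 A = \int[gauss]_w gaussT m [set W | A (cons_tuple w W)])%E.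
Proof.
by rewrite /= /distribution /pushforward prod_probE.
Qed.

Lemma gaussT0 (A : set (0.-tuple RM)) : gaussT 0 A = (\1_A [tuple])%:E.
Proof. by []. Qed.

Lemma vdotS m (x : 'I_m.+1 -> R) w (W : m.-tuple R) :
  vdot x (tnth (cons_tuple w W)) = x ord0 * w + vdot (x \o lift ord0) (tnth W).
Proof.
rewrite /vdot big_ord_recl tnth0; congr (_ + _); apply: eq_bigr => i _.
by rewrite tnthS.
Qed.

Lemma sqnormS m w (W : m.-tuple R) :
  vdot (tnth (cons_tuple w W)) (tnth (cons_tuple w W)) = w ^+ 2 + vdot (tnth W) (tnth W).
Proof. by rewrite vdotS tnth0 expr2; congr (_ + _); apply: eq_bigr => i _; rewrite /= tnthS. Qed.

Lemma measurable_vdot d (T : measurableType d) m (X Y : T -> 'I_m -> R) :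
  (forall i, measurable_fun setT (fun t => X t i)) ->
  (forall i, measurable_fun setT (fun t => Y t i)) ->
  measurable_fun setT (fun t => vdot (X t) (Y t)).
Proof.
move=> mX mY; apply: measurable_sum => i.
exact: measurable_funM.
Qed.

Lemma measurable_tnthR m (i : 'I_m) : measurable_fun setT (fun W : m.-tuple RM => (tnth W i : R)).
Proof. exact: measurable_tnth. Qed.

End gaussT.

Global Opaque gaussT.

(** * Isotropy of Gaussian vectors *)

Section gaussT_law.
Context {R : realType}.
Local Notation RM := (measurableTypeR R).

(** The half turn of the plane, observed on the first coordinate alone. *)
Lemma gauss_sym (A : set RM) : measurable A -> gauss (-%R @^-1` A) = gauss A.
Proof.
move=> mA.
have mN : measurable (-%R @^-1` A : set RM).
  by rewrite -[X in measurable X]setTI; apply: measurable_funN.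
have := @gauss_plane_rot R (-1) 0 (A `*` setT).
rewrite sqrrN expr1n expr0n addr0 => /(_ erefl (measurableX mA measurableT)).
rewrite (_ : plane_rot _ _ @^-1` _ = (-%R @^-1` A) `*` setT); last first.
  by apply/seteqP; split=> -[x y]/=; rewrite /plane_rot/= mulN1r mul0r addr0.
rewrite !product_measure1E// => H.
rewrite -[LHS]mule1 -[RHS]mule1 -(probability_setT (@gauss R)).
exact: H.
Qed.

(** Splits off two coordinates at once and integrates them first, where planar rotations
    act. *)
Lemma gaussTSS m (A : set (m.+2.-tuple RM)) : measurable A ->
  (gaussT m.+2 A = \int[gaussT m]_W prod_prob gauss gauss
     [set p | A (cons_tuple p.1 (cons_tuple p.2 W))])%E.
Proof.
move=> mA.
pose c3 (q : (RM * RM) * m.-tuple RM) : m.+2.-tuple RM :=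
  cons_tuple q.1.1 (cons_tuple q.1.2 q.2).
have mc3 : measurable_fun setT c3.
  apply: measurable_cons; first exact: measurableT_comp.
  by apply: measurable_cons => //; exact: measurableT_comp.
have mE : measurable (c3 @^-1` A).
  by rewrite -[X in measurable X]setTI; exact: mc3.
rewrite -(prod_probEr (prod_prob gauss gauss) (gaussT m) mE) prod_probE.
have mS := measurable_prod_prob_section (gaussT m) mE.
rewrite (ge0_integral_prod_prob gauss gauss mS (fun p => measure_ge0 _ _)).
rewrite gaussTS; apply: eq_integral => x _; exact: gaussTS.
Qed.

(** The joint law of [<x, W>] and [|W|^2] for a Gaussian vector [W] depends on [x] only
    through its norm. By induction on the dimension the tail of [x] may be replaced by
    any other tail of the same norm, hence by a vector supported on one coordinate; a
    rotation in the plane of the first two coordinates then brings [x] to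
    [(|x|, 0, ..., 0)]. *)
Lemma gaussT_law m (x y : 'I_m -> R) (B : set (RM * RM)) :
  measurable B -> vdot x x = vdot y y ->
  gaussT m [set W | B (vdot x (tnth W), vdot (tnth W) (tnth W))] =
  gaussT m [set W | B (vdot y (tnth W), vdot (tnth W) (tnth W))].
Proof.
elim: m x y B => [|m IH] x y B mB xy.
  by congr (gaussT _ _); apply/seteqP; split => W /=; rewrite /vdot !big_ord0.
have mV k (z : 'I_k -> R) : measurable_fun setT (fun W : k.-tuple RM =>
    (vdot z (tnth W), vdot (tnth W) (tnth W)) : RM * RM).
  apply: measurable_fun_pair; apply: measurable_vdot => // i; exact: measurable_tnthR.
have tail (z z' : 'I_m.+1 -> R) : z ord0 = z' ord0 ->
    vdot (z \o lift ord0) (z \o lift ord0) = vdot (z' \o lift ord0) (z' \o lift ord0) ->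
    gaussT m.+1 [set W | B (vdot z (tnth W), vdot (tnth W) (tnth W))] =
    gaussT m.+1 [set W | B (vdot z' (tnth W), vdot (tnth W) (tnth W))].
  move=> z0 zz'; rewrite !gaussTS; apply: eq_integral => w _.
  pose Bw := (fun p : RM * RM => (z ord0 * w + p.1, w ^+ 2 + p.2)) @^-1` B.
  have mBw : measurable Bw.
    rewrite -[X in measurable X]setTI; apply: (_ : measurable_fun setT _) => //.
    by apply: measurable_fun_pair => /=; apply: measurable_funD.
  transitivity (gaussT m [set W | Bw (vdot (z \o lift ord0) (tnth W), vdot (tnth W) (tnth W))]).
    by congr (gaussT _ _); apply/seteqP; split => W /=; rewrite vdotS sqnormS.
  rewrite (IH _ _ _ mBw zz').
  by congr (gaussT _ _); apply/seteqP; split => W /=; rewrite vdotS sqnormS -z0.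
(* In dimension one the two vectors differ by a sign, and the Gaussian law is
   symmetric. *)
case: m => [|m] in x y IH mV tail xy *.
  have : x ord0 = y ord0 \/ x ord0 = - y ord0.
    have := xy; rewrite /vdot !big_ord_recl !big_ord0 !addr0 -!expr2 => /eqP.
    by rewrite eqf_sqr => /orP[]/eqP; [left|right].
  case=> [x0|x0]; first by apply: tail => //; rewrite /vdot !big_ord0.
  have one (z : 'I_1 -> R) :
      gaussT 1 [set W | B (vdot z (tnth W), vdot (tnth W) (tnth W))] =
      gauss [set w | B (z ord0 * w, w ^+ 2)].
    rewrite gaussTS.
    have mA : measurable [set w : RM | B (z ord0 * w, w ^+ 2)].
      rewrite -[X in measurable X]setTI.
      apply: (_ : measurable_fun setT (fun w : RM => (z ord0 * w, w ^+ 2) : RM * RM)) => //.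
      by apply: measurable_fun_pair => /=; [exact: measurable_funM|exact: measurable_funX].
    transitivity (gauss ([set w : RM | B (z ord0 * w, w ^+ 2)] `&` setT)); last by rewrite setIT.
    rewrite -integral_indic//; apply: eq_integral => w _.
    rewrite gaussT0 !indicE; congr ((nat_of_bool _)%:R)%:E; apply/idP/idP; rewrite !inE /=.
      by rewrite vdotS sqnormS /vdot !big_ord0 !addr0.
    by rewrite vdotS sqnormS /vdot !big_ord0 !addr0.
  rewrite !one -gauss_sym.
    congr (gauss _); apply/seteqP; split => w /=; by rewrite x0 mulrN mulNr opprK sqrrN.
  rewrite -[X in measurable X]setTI.
  apply: (_ : measurable_fun setT (fun w : RM => (x ord0 * w, w ^+ 2) : RM * RM)) => //.
  by apply: measurable_fun_pair => /=; [exact: measurable_funM|exact: measurable_funX].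
(* [nrm z] is the vector [(|z|, 0, ..., 0)], common to all vectors of the same norm. *)
pose nrm (z : 'I_m.+2 -> R) (i : 'I_m.+2) : R := if i == ord0 then Num.sqrt (vdot z z) else 0.
have canon z : gaussT m.+2 [set W | B (vdot z (tnth W), vdot (tnth W) (tnth W))] =
    gaussT m.+2 [set W | B (vdot (nrm z) (tnth W), vdot (tnth W) (tnth W))].
  pose s := Num.sqrt (vdot (z \o lift ord0) (z \o lift ord0)).
  (* [z1] has the same head as [z] and a tail concentrated on its first coordinate. *)
  pose z1 : 'I_m.+2 -> R := fun i => if i == ord0 then z ord0 else if i == lift ord0 ord0 then s else 0.
  have z1E : vdot (z1 \o lift ord0) (z1 \o lift ord0) = vdot (z \o lift ord0) (z \o lift ord0).
    rewrite {1}/vdot big_ord_recl big1 ?addr0 => [|i _]; last first.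
      by rewrite /z1 /= mulr0.
    by rewrite /z1 /= -expr2 sqr_sqrtr ?vdot_ge0.
  transitivity (gaussT m.+2 [set W | B (vdot z1 (tnth W), vdot (tnth W) (tnth W))]).
    by apply: tail; [|rewrite z1E].
  have rE : vdot z z = z ord0 ^+ 2 + s ^+ 2.
    by rewrite {1}/vdot big_ord_recl -expr2 sqr_sqrtr ?vdot_ge0.
  have vz1 (p : RM * RM) (W : m.-tuple RM) :
      vdot z1 (tnth (cons_tuple p.1 (cons_tuple p.2 W))) = z ord0 * p.1 + s * p.2.
    rewrite !vdotS /z1 /= [X in _ + (_ + X)](_ : _ = 0) ?addr0//.
    by rewrite /vdot big1// => i _; rewrite /= mul0r.
  have [r r2 vnz] : exists2 r, r ^+ 2 = z ord0 ^+ 2 + s ^+ 2 &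
      forall (p : RM * RM) (W : m.-tuple RM),
        vdot (nrm z) (tnth (cons_tuple p.1 (cons_tuple p.2 W))) = r * p.1.
    exists (Num.sqrt (vdot z z)) => [|p W]; first by rewrite sqr_sqrtr ?vdot_ge0.
    rewrite !vdotS /nrm /= mul0r add0r [X in _ + X](_ : _ = 0) ?addr0//.
    by rewrite /vdot big1// => i _; rewrite /= mul0r.
  have [r0|r0] := eqVneq r 0.
    have r20 : z ord0 ^+ 2 + s ^+ 2 = 0 by rewrite -r2 r0 expr0n.
    have z00 : z ord0 = 0.
      by have := sqr_ge0 s; have := sqr_ge0 (z ord0); nra.
    have s0 : s = 0.
      by have := sqr_ge0 s; have := sqr_ge0 (z ord0); nra.
    congr (gaussT _ _); apply/seteqP; split=> W /=;
      case/tupleP: W => a W; case/tupleP: W => b W.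
      by rewrite (vz1 (a, b)) (vnz (a, b)) r0 z00 s0 !mul0r addr0.
    by rewrite (vz1 (a, b)) (vnz (a, b)) r0 z00 s0 !mul0r addr0.
  have mB' (v : 'I_m.+2 -> R) : measurable [set W : m.+2.-tuple RM |
      B (vdot v (tnth W), vdot (tnth W) (tnth W))].
    by rewrite -[X in measurable X]setTI; exact: mV.
  rewrite (gaussTSS (mB' z1)) (gaussTSS (mB' (nrm z))); apply: eq_integral => W _.
  pose Bt := [set p : RM * RM | B (r * p.1, p.1 ^+ 2 + (p.2 ^+ 2 + vdot (tnth W) (tnth W)))].
  have mBt : measurable Bt.
    rewrite -[X in measurable X]setTI.
    apply: (_ : measurable_fun setT (fun p : RM * RM => (r * p.1,
      p.1 ^+ 2 + (p.2 ^+ 2 + vdot (tnth W) (tnth W))) : RM * RM)) => //.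
    apply: measurable_fun_pair => /=; first exact: measurable_funM.
    by apply: measurable_funD; [|apply: measurable_funD => //]; apply: measurable_funX.
  have rotl (p : RM * RM) : r * (z ord0 / r * p.1 + s / r * p.2) = z ord0 * p.1 + s * p.2.
    by field.
  have rotn (p : RM * RM) : (z ord0 / r * p.1 + s / r * p.2) ^+ 2 +
      ((- (s / r) * p.1 + z ord0 / r * p.2) ^+ 2 + vdot (tnth W) (tnth W)) =
      p.1 ^+ 2 + (p.2 ^+ 2 + vdot (tnth W) (tnth W)).
    rewrite !addrA; congr (_ + _).
    transitivity ((z ord0 ^+ 2 + s ^+ 2) / r ^+ 2 * (p.1 ^+ 2 + p.2 ^+ 2)).
      by field.
    by rewrite -r2 divff ?mul1r// expf_neq0.
  transitivity (prod_prob gauss gauss (plane_rot (z ord0 / r) (s / r) @^-1` Bt)).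
    congr (prod_prob _ _ _); apply/seteqP; split => p /=; rewrite vz1 !sqnormS /plane_rot /Bt /=.
      by rewrite rotl -rotn.
    by rewrite rotl rotn.
  have zsr : (z ord0 / r) ^+ 2 + (s / r) ^+ 2 = 1.
    by rewrite !expr_div_n -mulrDl -r2 divff// expf_neq0.
  transitivity (prod_prob gauss gauss Bt); first exact: gauss_plane_rot zsr mBt.
  by congr (prod_prob _ _ _); apply/seteqP; split => p /=; rewrite vnz !sqnormS.
rewrite canon [RHS]canon; suff -> : nrm x = nrm y by [].
by apply/funext => i; rewrite /nrm; case: ifP => // _; congr Num.sqrt.
Qed.

End gaussT_law.

(** * The ratio of two independent Gaussian variables *)

Section gauss_ratio.
Context {R : realType}.
Local Notation lambda := (@lebesgue_measure R).
Local Notation RM := (measurableTypeR R).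

Lemma is_derive_gauss (c x : R) : c != 0 ->
  is_derive x 1 (fun y : R => - c^-1 * expR (- (c / 2) * y ^+ 2)) (x * expR (- (c / 2) * x ^+ 2)).
Proof.
move=> c0.
have h1 : is_derive x 1 (fun y : R => - (c / 2) * y ^+ 2) (- (c * x)).
  by apply: is_derive_eq; rewrite /GRing.scale/=; field.
have h2 : is_derive x 1 (fun y : R => expR (- (c / 2) * y ^+ 2)) (- (c * x) * expR (- (c / 2) * x ^+ 2)).
  have := @is_derive1_comp R expR (fun y : R => - (c / 2) * y ^+ 2) x _ _ (is_derive_expR _) h1.
  by rewrite [expR _ * _]mulrC.
have := is_deriveZ (- c^-1) h2.
rewrite (_ : - c^-1 *: _ = x * expR (- (c / 2) * x ^+ 2))//.
by rewrite /GRing.scale/=; field.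
Qed.

Lemma continuous_gaussc (c : R) : continuous (fun y : R => expR (- (c / 2) * y ^+ 2)).
Proof.
move=> x; apply: (@continuous_comp _ _ _ (fun x : R => - (c / 2) * x ^+ 2) expR).
  apply: cvgM; first exact: cvg_cst.
  exact: exprn_continuous.
exact: continuous_expR.
Qed.

(** An antiderivative is [- c^-1 * expR (- (c / 2) * x ^+ 2)]. *)
Lemma integral_half_moment (c : R) : 0 < c ->
  (\int[lambda]_(x in `[0%R, +oo[) (x * expR (- (c / 2) * x ^+ 2))%:E = c^-1%:E)%E.
Proof.
move=> c0; have c0' : c != 0 by rewrite gt_eqF.
pose F := fun y => - c^-1 * expR (- (c / 2) * y ^+ 2).
have dF x := is_derive_gauss x c0'.
rewrite (@ge0_continuous_FTC2y _ _ F 0 0).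
- by rewrite /F expr0n/= mulr0 expR0 mulr1 -EFinB sub0r opprK.
- by move=> x x0; rewrite mulr_ge0// expR_ge0.
- apply: continuous_subspaceT => x; apply: cvgM; first exact: cvg_id.
  exact: continuous_gaussc.
- rewrite /F -[X in _ --> X](mulr0 (- c^-1)); apply: cvgM; first exact: cvg_cst.
  rewrite (_ : (fun y => _) = (fun x => expR (- x)) \o (fun x : R => x ^+ 2 * (c / 2))).
    apply: cvg_comp; last exact: cvgr_expR.
    by apply: gt0_cvgMly; [rewrite divr_gt0|exact: cvgr_expr2].
  by apply/funext => y /=; rewrite mulNr mulrC.
- by move=> x _; exact: ex_derive.
- apply: cvg_at_right_filter; apply: differentiable_continuous.
  by apply/derivable1_diffP; exact: ex_derive.
- by move=> x _; rewrite derive1E; exact: derive_val.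
Qed.

(** The density of the standard Cauchy law. *)
Definition gauss_ratio_pdf (s : R) : R := (pi * (1 + s ^+ 2))^-1.

Lemma normal_peak_sq : @normal_peak R 1 ^+ 2 = (2 * pi)^-1.
Proof.
rewrite /normal_peak expr1n mul1r exprVn sqr_sqrtr; first by rewrite mulr_natl.
by rewrite mulrn_wge0// pi_ge0.
Qed.

(** The Jacobian [|w|] of the substitution [z = s * w] makes the Gaussian integral over
    [w] elementary: this is the density at [s] of the ratio of two independent Gaussian
    variables. *)
Lemma integral_absM_gauss_pdf (s : R) :
  (\int[lambda]_w (`|w| * gauss_pdf w * gauss_pdf (s * w))%:E = (gauss_ratio_pdf s)%:E)%E.
Proof.
have c0 : 0 < 1 + s ^+ 2 by rewrite ltr_pwDl ?sqr_ge0.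
have E w : `|w| * gauss_pdf w * gauss_pdf (s * w) =
    (2 * pi)^-1 * (`|w| * expR (- ((1 + s ^+ 2) / 2) * w ^+ 2)).
  rewrite !gauss_pdfE -normal_peak_sq.
  have -> : - ((1 + s ^+ 2) / 2) * w ^+ 2 = - (w ^+ 2 / 2) + - ((s * w) ^+ 2 / 2) by field.
  by rewrite expRD; ring.
under eq_integral do rewrite E.
have cE : continuous (fun w : R => `|w| * expR (- ((1 + s ^+ 2) / 2) * w ^+ 2)).
  move=> x; apply: cvgM; first exact: norm_continuous.
  exact: continuous_gaussc.
under eq_integral do rewrite EFinM.
rewrite ge0_integralZl//; last 2 first.
- by apply/measurable_EFinP; exact: continuous_measurable_fun.
- by rewrite lee_fin invr_ge0 mulr_ge0// pi_ge0.
rewrite ge0_symfun_integralT//; last first.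
  by move=> w /=; rewrite normrN sqrrN.
rewrite -set_itvcy (_ : (\int[lambda]_(x in _) _)%E = (1 + s ^+ 2)^-1%:E); last first.
  rewrite -integral_half_moment//; apply: eq_integral => x.
  by rewrite inE/= in_itv/= andbT => x0; rewrite ger0_norm.
rewrite -!EFinM /gauss_ratio_pdf; congr EFin; move: (@pi R) (pi_gt0 R) => p p0.
by field; rewrite !gt_eqF.
Qed.

Lemma integral_gauss_ratio_pdf (t : R) : 0 < t ->
  (\int[lambda]_(s in [set s | `|s| < t]%R) (gauss_ratio_pdf s)%:E =
   (2 / pi * atan t)%:E)%E.
Proof.
move=> t0.
have cp : continuous gauss_ratio_pdf.
  move=> x; apply: cvgV; first by rewrite mulf_neq0 ?gt_eqF ?pi_gt0// ltr_pwDl ?sqr_ge0.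
  apply: cvgM; first exact: cvg_cst.
  apply: cvgD; first exact: cvg_cst.
  exact: exprn_continuous.
rewrite (_ : [set s | _] = `]- t, t[%classic); last first.
  by apply/seteqP; split=> x /=; rewrite in_itv/= ltr_norml.
have mp : measurable_fun setT (fun s : RM => (gauss_ratio_pdf s)%:E).
  by apply/measurable_EFinP; exact: continuous_measurable_fun.
rewrite integral_itv_bndo_bndc; last exact: measurable_funTS.
rewrite integral_itv_obnd_cbnd; last exact: measurable_funTS.
have dF (x : R) : is_derive x 1 (fun x => pi^-1 * atan x) (gauss_ratio_pdf x).
  apply: is_derive_eq; rewrite /GRing.scale/= /gauss_ratio_pdf invfM//.
have cF (x : R) : {for x, continuous (fun x => pi^-1 * atan x)}.
  apply: differentiable_continuous; apply/derivable1_diffP; exact: ex_derive.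
rewrite (@continuous_FTC2 _ _ (fun x => pi^-1 * atan x) (- t) t).
- by rewrite atanN -EFinB; congr EFin; move: (@pi R) (pi_gt0 R) => p p0; field; rewrite gt_eqF.
- by rewrite gtrN.
- exact: continuous_subspaceT.
- split => [x _||]; first exact: ex_derive.
    apply: cvg_at_right_filter; exact: cF.
  apply: cvg_at_left_filter; exact: cF.
- by move=> x _; rewrite derive1E; exact: derive_val.
Qed.

End gauss_ratio.

Section ratio_law.
Context {R : realType}.
Local Notation lambda := (@lebesgue_measure R).
Local Notation RM := (measurableTypeR R).

Lemma measurable_norm_lt (c : R) : measurable [set z : RM | `|z| < c].
Proof.
rewrite (_ : [set z | _] = `]- c, c[%classic); first exact: measurable_itv.
by apply/seteqP; split=> x /=; rewrite in_itv/= ltr_norml.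
Qed.

Lemma measurable_ratio_lt (t : R) : measurable [set p : RM * RM | `|p.2| < t * `|p.1|].
Proof.
apply: measurable_set_ltr; first exact: measurableT_comp.
by apply: measurable_funM => //; exact: measurableT_comp.
Qed.

(** The substitution [z = s * w] turns the event [|z| < t * |w|] into [|s| < t],
    whatever the value of [w]. *)
Lemma gauss_norm_lt_scale (t w : R) :
  (gauss [set z : RM | `|z| < t * `|w|]%R =
   \int[lambda]_s ((`|s| < t)%R%:R * (`|w| * gauss_pdf (s * w)))%:E)%E.
Proof.
have [->|w0] := eqVneq w 0.
  rewrite (_ : [set z | _] = set0); last first.
    by apply/seteqP; split=> z //=; rewrite normr0 mulr0 normr_lt0.
  rewrite measure0; under eq_integral do rewrite normr0 mul0r mulr0.
  by rewrite integral0.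
have w0' : 0 < `|w| by rewrite normr_gt0.
pose f (z : RM) := ((`|z| < t * `|w|)%R%:R * gauss_pdf z)%:E.
have mf : measurable_fun setT f.
  apply/measurable_EFinP; apply: measurable_funM; last exact: measurable_gauss_pdf.
  rewrite (_ : (fun _ => _) = \1_[set z : RM | `|z| < t * `|w|]); last first.
    by apply/funext => z; rewrite indicE mem_setb.
  apply: measurable_indic; exact: measurable_norm_lt.
have f0 x : (0 <= f x)%E by rewrite lee_fin mulr_ge0// ltW// gauss_pdf_gt0.
transitivity (\int[lambda]_z f z)%E.
  rewrite gaussE integral_mkcond; apply: eq_integral => z _.
  by rewrite patchE mem_setb /f; case: ifP => _; rewrite ?mul1r ?mul0r.
transitivity (`|w|%:E * \int[lambda]_s f (w * s + 0)%R)%E.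
  exact/esym/(ge0_integral_affine 0 w0 mf f0).
rewrite -ge0_integralZl; last 4 first.
- by [].
- exact: (measurableT_comp mf (measurable_affine w 0)).
- by move=> s _; exact: f0.
- by rewrite lee_fin.
apply: eq_integral => s _; rewrite -EFinM /f addr0 mulrCA; congr (_ * _)%:E.
  by rewrite normrM mulrC ltr_pM2r.
by rewrite [w * s]mulrC.
Qed.

(** For independent Gaussian [z] and [w] the ratio [z / w] has the Cauchy law, and the
    probability that it lies in [`]- t, t[] is [2 / pi * atan t]. Here [z] is integrated
    first; exchanging the integrals leaves the density of the ratio. *)
Lemma gauss_ratio_law (t : R) : 0 < t ->
  (\int[gauss]_w gauss [set z : RM | `|z| < t * `|w|]%R = (2 / pi * atan t)%:E)%E.
Proof.
move=> t0.
rewrite integral_gauss; last 2 first.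
- apply: (@measurable_prod_prob_section _ _ _ _ _ gauss [set p : RM * RM | `|p.2| < t * `|p.1|]).
  exact: measurable_ratio_lt.
- by move=> w; rewrite measure_ge0 probability_le1//; exact: measurable_norm_lt.
pose F (p : RM * RM) := ((`|p.2| < t)%R%:R * (`|p.1| * gauss_pdf p.1 * gauss_pdf (p.2 * p.1)))%:E.
have m1 : measurable_fun setT (fun p : RM * RM => (`|p.2| < t)%R%:R : R).
  rewrite (_ : (fun _ => _) = \1_[set z : RM | `|z| < t] \o snd); last first.
    by apply/funext => z; rewrite /= indicE mem_setb.
  apply: measurableT_comp => //; apply: measurable_indic; exact: measurable_norm_lt.
have mF : measurable_fun setT F.
  apply/measurable_EFinP; apply: measurable_funM => //.
  apply: measurable_funM; first apply: measurable_funM.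
  - exact: measurableT_comp.
  - by apply: measurableT_comp => //; exact: measurable_gauss_pdf.
  - apply: measurableT_comp; first exact: measurable_gauss_pdf.
    exact: measurable_funM.
have F0 p : (0 <= F p)%E.
  by rewrite lee_fin !mulr_ge0// ltW// gauss_pdf_gt0.
have mfs : measurable_fun setT (fun p : RM * RM =>
    ((`|p.2| < t)%R%:R * (`|p.1| * gauss_pdf (p.2 * p.1)))%:E).
  apply/measurable_EFinP; apply: measurable_funM => //.
  apply: measurable_funM; first exact: measurableT_comp.
  apply: measurableT_comp; first exact: measurable_gauss_pdf.
  exact: measurable_funM.
transitivity (\int[lambda]_w \int[lambda]_s F (w, s))%E.
  apply: eq_integral => w _.
  rewrite gauss_norm_lt_scale muleC -ge0_integralZl; last 4 first.
  - by [].
  - exact: (measurableT_comp mfs (pair1_measurable w)).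
  - by move=> s _; rewrite lee_fin !mulr_ge0// ltW// gauss_pdf_gt0.
  - by rewrite lee_fin ltW// gauss_pdf_gt0.
  apply: eq_integral => s _; rewrite -EFinM /F/=; congr EFin; ring.
transitivity (\int[lambda]_s \int[lambda]_w F (w, s))%E.
  exact: (fubini_tonelli (m1:=lambda) (m2:=lambda) _ mF F0).
rewrite -integral_gauss_ratio_pdf// [RHS]integral_mkcond; apply: eq_integral => s _.
rewrite patchE mem_setb /F/=; case: ifP => _.
  by under eq_integral do rewrite mul1r; rewrite integral_absM_gauss_pdf.
by under eq_integral do rewrite mul0r; rewrite integral0.
Qed.

End ratio_law.

(** * Caps, cones and isotropic vectors *)

Section caps.
Context {R : realType}.

Lemma vdotC m (x y : 'I_m -> R) : vdot x y = vdot y x.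
Proof. by apply: eq_bigr => i _; rewrite mulrC. Qed.

Lemma vdotZl m (c : R) (x y : 'I_m -> R) : vdot (fun i => c * x i) y = c * vdot x y.
Proof. by rewrite /vdot mulr_sumr; apply: eq_bigr => i _; rewrite mulrA. Qed.

Lemma vdotZr m (c : R) (x y : 'I_m -> R) : vdot x (fun i => c * y i) = c * vdot x y.
Proof. by rewrite vdotC vdotZl vdotC. Qed.

(** For [0 <= rho < 1], the vectors [y] whose line makes a small angle with the line of
    [x], namely one whose squared cosine exceeds [rho]. No division is used, so that the
    condition is false when [x] or [y] is zero. *)
Definition cap m (rho : R) (x y : 'I_m -> R) : bool :=
  rho * (vdot x x * vdot y y) < vdot x y ^+ 2.

Lemma capC m rho (x y : 'I_m -> R) : cap rho x y = cap rho y x.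
Proof. by rewrite /cap (vdotC x y) [vdot x x * _]mulrC. Qed.

Lemma capZl m (rho c : R) (x y : 'I_m -> R) : c != 0 ->
  cap rho (fun i => c * x i) y = cap rho x y.
Proof.
move=> c0; rewrite /cap !vdotZl vdotZr.
rewrite (_ : rho * _ = c ^+ 2 * (rho * (vdot x x * vdot y y))); last by ring.
by rewrite exprMn ltr_pM2l// exprn_even_gt0.
Qed.

(** The random line spanned by [V] has no preferred direction, in the only form needed
    below: the probability that it is close to a given line does not depend on that
    line. *)
Definition isotropic d (T : measurableType d) (P : probability T R) m
    (V : T -> 'I_m -> R) : Prop :=
  forall rho x y, 0 < vdot x x -> 0 < vdot y y ->
    P [set t | cap rho x (V t)] = P [set t | cap rho y (V t)].

(** The cone over the open cube [`]- t, t[ ^ d] placed at height [1] in the coordinate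
    [ord0]. *)
Definition cone d (t : R) (v : 'I_d.+1 -> R) : bool :=
  [forall i, `|v (lift ord0 i)| < t * `|v ord0| ].

End caps.

Section gaussT_props.
Context {R : realType}.
Local Notation RM := (measurableTypeR R).

(** After rescaling one of the two vectors, this is [gaussT_law] for the event that
    defines [cap]. *)
Lemma gaussT_isotropic m : isotropic (gaussT m) (fun W : m.-tuple RM => tnth W : 'I_m -> R).
Proof.
move=> rho x y x0 y0.
pose c := Num.sqrt (vdot x x / vdot y y).
have c0 : c != 0 by rewrite gt_eqF// sqrtr_gt0 divr_gt0.
have cE : vdot x x = vdot (fun i => c * y i) (fun i => c * y i).
  rewrite vdotZl vdotZr mulrA -expr2 sqr_sqrtr ?divfK// ?gt_eqF//.
  by rewrite ltW// divr_gt0.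
pose B := [set p : RM * RM | rho * (vdot x x * p.2) < p.1 ^+ 2].
have mB : measurable B.
  apply: measurable_set_ltr; last by apply: measurable_funX.
  by do 2 apply: measurable_funM => //.
transitivity (gaussT m [set W | B (vdot x (tnth W), vdot (tnth W) (tnth W))]).
  by [].
rewrite (gaussT_law mB cE); congr (gaussT _ _); apply/seteqP; split=> W /=.
  by rewrite /B /= cE -/(cap rho (fun i => c * y i) (tnth W)) capZl.
by rewrite /B /= cE -/(cap rho (fun i => c * y i) (tnth W)) capZl.
Qed.

Lemma integral_gt0 d (T : measurableType d) (P : probability T R) (f : T -> \bar R) :
  measurable_fun setT f -> (forall x, 0 < f x)%E -> (0 < \int[P]_x f x)%E.
Proof.
move=> mf f0; rewrite lt0e integral_ge0 ?andbT; last by move=> x _; exact: ltW.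
apply/eqP => i0.
have : (\int[P]_x `|f x| = 0)%E.
  by rewrite -[RHS]i0; apply: eq_integral => x _; rewrite gee0_abs// ltW.
move/(ae_eq_integral_abs P measurableT mf) => [N [mN N0 sub]].
have NT : N = setT.
  apply/seteqP; split=> // x _; apply: sub => /= /(_ I) fx.
  by have := f0 x; rewrite fx ltxx.
by have := probability_setT P; rewrite -NT N0 => /eqP; rewrite eqe eq_sym oner_eq0.
Qed.

(** By isotropy [x] may be taken to be the first basis vector. For fixed values of the
    other coordinates the cap then contains a tail event of the first coordinate, which
    has positive probability. *)
Lemma gaussT_cap_gt0 m (rho : R) (x : 'I_m.+1 -> R) : rho < 1 -> 0 <= rho ->
  0 < vdot x x -> (0 < gaussT m.+1 [set W | cap rho x (tnth W)])%E.
Proof.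
move=> r1 r0 x0.
pose e (i : 'I_m.+1) : R := (i == ord0)%:R.
have ve (W : 'I_m.+1 -> R) : vdot e W = W ord0.
  rewrite /vdot big_ord_recl big1 ?addr0 /e ?eqxx ?mul1r// => i _.
  by rewrite mul0r.
have e0 : 0 < vdot e e by rewrite ve /e eqxx.
rewrite (gaussT_isotropic rho x0 e0) gaussTS.
pose E := [set p : RM * m.-tuple RM | rho * (p.1 ^+ 2 + vdot (tnth p.2) (tnth p.2)) < p.1 ^+ 2].
have mE : measurable E.
  apply: measurable_set_ltr; last by apply: measurable_funX.
  apply: measurable_funM => //; apply: measurable_funD; first exact: measurable_funX.
  by apply: measurable_vdot => i; exact: (measurableT_comp (measurable_tnthR i) measurable_snd).
rewrite (_ : integral _ _ _ = prod_prob gauss (gaussT m) E); last first.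
  rewrite prod_probE; apply: eq_integral => w _; congr (gaussT _ _).
  by apply/seteqP; split=> W; rewrite /E /= /cap sqnormS !ve /e eqxx mul1r tnth0.
rewrite (prod_probEr gauss (gaussT m) mE).
pose E' := [set q : m.-tuple RM * RM | E (q.2, q.1)].
have mE' : measurable E'.
  have msw : measurable_fun setT (fun q : m.-tuple RM * RM => (q.2, q.1)).
    exact: measurable_fun_pair.
  by have := msw measurableT E mE; rewrite setTI.
apply: integral_gt0.
  exact: (measurable_prod_prob_section gauss mE').
move=> W; set q := vdot (tnth W) (tnth W).
have q0 : 0 <= q by exact: vdot_ge0.
apply: lt_le_trans (gauss_tail_gt0 (1 + rho * q / (1 - rho))) _.
apply: le_measure; rewrite ?inE.
- apply: measurable_set_ltr => //.
- have mW : measurable_fun setT (fun w : RM => (w, W)) by exact: measurable_fun_pair.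
  by have := mW measurableT E mE; rewrite setTI.
move=> w /=; rewrite /E /= -/q => cw.
have r1' : 0 < 1 - rho by rewrite subr_gt0.
have k0 : 0 <= rho * q / (1 - rho) by rewrite divr_ge0 ?mulr_ge0// ltW.
have : rho * q / (1 - rho) < w ^+ 2 by nra.
rewrite ltr_pdivrMr// => h; nra.
Qed.

End gaussT_props.

(** * Gaussian probability of the cone over a cube *)

Section jensen.
Context {R : realType}.

(** A convex power lies above its tangent at [m]. *)
Lemma power_tangent (n : nat) (m a : R) : 0 <= m -> 0 <= a ->
  (n.+1%:R * m ^+ n) * a <= a ^+ n.+1 + n%:R * m ^+ n.+1.
Proof.
move=> m0 a0; elim: n => [|n IH]; first by rewrite !expr0 expr1 mul0r addr0 mulr1 mul1r.
have := ler_wpM2l a0 IH.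
have : 0 <= n.+1%:R * m ^+ n * (a - m) ^+ 2.
  by rewrite mulr_ge0 ?sqr_ge0// mulr_ge0 ?exprn_ge0.
rewrite [a ^+ n.+2]exprS [m ^+ n.+2]exprS [m ^+ n.+1]exprS -!natr1.
set u := a ^+ n.+1; set v := m ^+ n; move: (n%:R : R) => k h1 h2.
rewrite -subr_ge0; rewrite -subr_ge0 in h2.
rewrite (_ : _ - _ = (a * (u + k * (m * v)) - a * ((k + 1) * v * a)) + (k + 1) * v * (a - m) ^+ 2).
  exact: addr_ge0.
by ring.
Qed.

(** Integrate the tangent inequality at the mean [m]. *)
Lemma jensen_power d (T : measurableType d) (P : probability T R) (f : T -> R)
    (m : R) (n : nat) :
  measurable_fun setT f -> (forall x, 0 <= f x <= 1) -> 0 <= m ->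
  (\int[P]_x (f x)%:E = m%:E)%E ->
  ((m ^+ n.+1)%:E <= \int[P]_x (f x ^+ n.+1)%:E)%E.
Proof.
move=> mf f01 m0 fm.
have f0 x : 0 <= f x by have /andP[] := f01 x.
have mfn : measurable_fun setT (fun x => (f x ^+ n.+1)%:E).
  by apply/measurable_EFinP; exact: measurable_funX.
have fn0 x : (0 <= (f x ^+ n.+1)%:E)%E by rewrite lee_fin exprn_ge0.
have c0 : 0 <= n%:R * m ^+ n.+1 by rewrite mulr_ge0// exprn_ge0.
have c1 : 0 <= n.+1%:R * m ^+ n by rewrite mulr_ge0// exprn_ge0.
have L : (\int[P]_x ((n.+1%:R * m ^+ n)%:E * (f x)%:E) = (n.+1%:R * m ^+ n.+1)%:E)%E.
  rewrite ge0_integralZl//; last 2 first.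
  - exact/measurable_EFinP.
  - by move=> x _; rewrite lee_fin.
  by rewrite fm -EFinM -mulrA -exprSr.
have U : (\int[P]_x ((f x ^+ n.+1)%:E + (n%:R * m ^+ n.+1)%:E) =
    \int[P]_x (f x ^+ n.+1)%:E + (n%:R * m ^+ n.+1)%:E)%E.
  rewrite ge0_integralD//.
  congr (_ + _)%E; rewrite integral_cst// -[RHS]mule1; congr (_ * _)%E.
  exact: probability_setT.
have : ((n.+1%:R * m ^+ n.+1)%:E <= \int[P]_x (f x ^+ n.+1)%:E + (n%:R * m ^+ n.+1)%:E)%E.
  rewrite -L -U; apply: ge0_le_integral => //.
  - by move=> x _; rewrite -EFinM lee_fin mulr_ge0.
  - by apply: emeasurable_funM => //; apply/measurable_EFinP.
  - by apply: emeasurable_funD.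
  - by move=> x _; rewrite -EFinM -EFinD lee_fin power_tangent.
by rewrite -leeBlDr// -EFinB -natr1 mulrDl mul1r addrC addKr.
Qed.

End jensen.

Section gaussT_cone.
Context {R : realType}.
Local Notation RM := (measurableTypeR R).

Lemma gaussT_box d (c : R) :
  gaussT d [set W | [forall i, `|tnth W i| < c] ] =
  (fine (gauss [set z : RM | `|z| < c]) ^+ d)%:E.
Proof.
set A := [set z : RM | `|z| < c].
have mA : measurable A by exact: measurable_norm_lt.
have fA : gauss A \is a fin_num by exact: fin_num_measure.
elim: d => [|d IH].
  rewrite gaussT0 indicE expr0 mem_set//=.
  by apply/forallP => -[].
rewrite gaussTS exprS EFinM fineK// -IH muleC.
rewrite -[gauss A]/((gauss \o id) A).
rewrite (_ : (gauss \o id) A = \int[gauss]_w (\1_A w)%:E)%E; last first.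
  by rewrite integral_indic//= setIT.
rewrite -ge0_integralZl//; last first.
  by apply/measurable_EFinP; exact: measurable_indic.
apply: eq_integral => w _; rewrite indicE mem_setb.
have [wc|wc] := boolP (`|w| < c).
  rewrite mule1; congr (gaussT _ _); apply/seteqP; split=> W /= /forallP h; apply/forallP => i.
    by have := h (lift ord0 i); rewrite tnthS.
  have [->|] := eqVneq i ord0; first by rewrite tnth0.
  by case: (unliftP ord0 i) => [j ->|->]; rewrite ?eqxx// tnthS.
rewrite mule0 (_ : [set W | _] = set0) ?measure0//.
apply/seteqP; split=> W //= /forallP/(_ ord0); rewrite tnth0.
by rewrite (negbTE wc).
Qed.

(** Given the first coordinate [w], the others are independent and each must lie at distance
    less than [t * |w|] from [0]. *)
Lemma gaussT_coneE d (t : R) :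
  (gaussT d.+1 [set W | cone t (tnth W)] =
   \int[gauss]_w (fine (gauss [set z : RM | `|z| < t * `|w| ]%R) ^+ d)%:E)%E.
Proof.
rewrite gaussTS; apply: eq_integral => w _; rewrite -gaussT_box.
congr (gaussT _ _); apply/seteqP; split=> W /= /forallP h; apply/forallP => i.
  by have := h i; rewrite tnthS tnth0.
by have := h i; rewrite tnthS tnth0.
Qed.

Let fineG (t w : R) : (fine (gauss [set z : RM | `|z| < t * `|w| ]%R))%:E =
  gauss [set z : RM | `|z| < t * `|w| ]%R.
Proof. by rewrite fineK//; apply: fin_num_measure; exact: measurable_norm_lt. Qed.

Lemma gaussT_cone1 (t : R) : 0 < t ->
  gaussT 2 [set W | cone t (tnth W)] = (2 / pi * atan t)%:E.
Proof.
move=> t0; rewrite gaussT_coneE -gauss_ratio_law//.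
by apply: eq_integral => w _; rewrite expr1 fineG.
Qed.

(** Jensen's inequality for the power [d.+1], applied to the conditional probability
    given the first coordinate, whose mean is given by [gauss_ratio_law]. *)
Lemma gaussT_cone_ge d (t : R) : 0 < t ->
  (((2 / pi * atan t) ^+ d.+1)%:E <= gaussT d.+2 [set W | cone t (tnth W)])%E.
Proof.
move=> t0; rewrite gaussT_coneE; apply: jensen_power.
- apply/measurable_EFinP.
  rewrite (_ : _ \o _ = fun w => gauss [set z : RM | `|z| < t * `|w| ]%R).
    exact: (measurable_prod_prob_section gauss (measurable_ratio_lt t)).
  by apply/funext => w; exact: fineG.
- move=> w; rewrite fine_ge0//= -lee_fin fineG probability_le1//.
  exact: measurable_norm_lt.
- by rewrite mulr_ge0 ?divr_ge0 ?pi_ge0// -atan0 ltW// lt_atan.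
- by rewrite -gauss_ratio_law//; apply: eq_integral => w _; rewrite fineG.
Qed.

End gaussT_cone.

(** * Isotropic vectors give the same probability to a cone *)

Section isotropic_uniqueness.
Context {R : realType}.

Lemma measurable_set_forall d (T : measurableType d) (I : finType) (b : I -> T -> bool) :
  (forall i, measurable [set t | b i t]) -> measurable [set t | [forall i, b i t] ].
Proof.
move=> mb; rewrite (_ : [set t | _] = \bigcap_(i in [set: I]) [set t | b i t]).
  by apply: fin_bigcap_measurable => //; exact: finite_finset.
apply/seteqP; split=> t /=; first by move=> /forallP h i _; exact: h.
by move=> h; apply/forallP => i; exact: h.
Qed.

Lemma measurable_cone d (T : measurableType d) m (t : R) (V : T -> 'I_m.+1 -> R) :
  (forall i, measurable_fun setT (fun x => V x i)) -> measurable [set x | cone t (V x)].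
Proof.
move=> mV; apply: measurable_set_forall => i; apply: measurable_set_ltr.
  exact: measurableT_comp.
by apply: measurable_funM => //; exact: measurableT_comp.
Qed.

Lemma measurable_cap d (T : measurableType d) m (rho : R) (V W : T -> 'I_m -> R) :
  (forall i, measurable_fun setT (fun x => V x i)) ->
  (forall i, measurable_fun setT (fun x => W x i)) ->
  measurable [set x | cap rho (V x) (W x)].
Proof.
move=> mV mW; apply: measurable_set_ltr.
  by apply: measurable_funM => //; apply: measurable_funM; exact: measurable_vdot.
by apply: measurable_funX; exact: measurable_vdot.
Qed.

Lemma cone_gt0 m (s : R) (x : 'I_m.+2 -> R) : cone s x -> x ord0 != 0.
Proof.
move=> /forallP/(_ ord0); apply: contraTneq => ->.
by rewrite normr0 mulr0 -leNgt.
Qed.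

Lemma sqr_coord_le m (x : 'I_m -> R) i : x i ^+ 2 <= vdot x x.
Proof.
rewrite /vdot (bigD1 i)//= -expr2 lerDl; apply: sumr_ge0 => j _.
by rewrite -expr2 sqr_ge0.
Qed.

Lemma cap_gt0 m (rho : R) (x y : 'I_m -> R) : cap rho x y -> 0 < vdot x x.
Proof.
rewrite /cap lt0r vdot_ge0 andbT; apply: contraTneq => x0.
rewrite x0 mul0r mulr0 /vdot big1 ?expr0n ?ltxx// => i _.
have : x i ^+ 2 <= 0 by rewrite -x0 sqr_coord_le.
by rewrite le_eqVlt ltNge sqr_ge0 orbF sqrf_eq0 => /eqP ->; rewrite mul0r.
Qed.

(** If [x] lies in the cone of aperture [s] and [y] spans a line close enough to that of
    [x], then [y] lies in the larger cone of aperture [t]. Write [y = c x + r] with [r]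
    orthogonal to [x]: the cap condition bounds [|r|] by a small multiple [eta] of [|c|
    * |x ord0|], and [(s + eta) / (1 - eta) = t] for [eta = (t - s) / (1 + t)]. *)
Lemma cap_cone m (s t : R) : 0 <= s -> s < t ->
  exists rho, [/\ 0 <= rho, rho < 1 &
    forall x y : 'I_m.+2 -> R, cone s x -> cap rho x y -> cone t y].
Proof.
move=> s0 st; have t0 : 0 < t by exact: le_lt_trans st.
(* [A * x ord0 ^+ 2] bounds the squared norm of the vectors [x] of the cone [s], and
   [rho] is chosen so that [(1 - rho) / rho * A = eta ^+ 2]. *)
pose A := 1 + m.+1%:R * s ^+ 2; pose eta := (t - s) / (1 + t).
have A1 : 1 <= A by rewrite lerDl mulr_ge0 ?sqr_ge0.
have A0 : 0 < A by exact: lt_le_trans A1.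
have t1 : 0 < 1 + t by rewrite addr_gt0.
have eta0 : 0 < eta by rewrite divr_gt0// subr_gt0.
have eta2 : 0 < eta ^+ 2 by rewrite exprn_gt0.
have Ae : 0 < A + eta ^+ 2 by rewrite addr_gt0.
exists (A / (A + eta ^+ 2)); split.
- by rewrite divr_ge0// ltW.
- by rewrite ltr_pdivrMr// mul1r ltrDl.
move=> x y cx cxy.
have x0 := cone_gt0 cx.
have x02 : 0 < x ord0 ^+ 2 by rewrite exprn_even_gt0.
have X0 : 0 < vdot x x by apply: lt_le_trans (sqr_coord_le x ord0).
have XA : vdot x x <= A * x ord0 ^+ 2.
  rewrite /vdot big_ord_recl -expr2 mulrDl mul1r lerD2l.
  apply: (@le_trans _ _ (\sum_(i < m.+1) s ^+ 2 * x ord0 ^+ 2)).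
    apply: ler_sum => i _; rewrite -expr2 -exprMn -ler_sqrt ?sqr_ge0// !sqrtr_sqr.
    by rewrite normrM (ger0_norm s0) ltW//; move/forallP: cx; exact.
  by rewrite sumr_const card_ord -[leLHS]mulr_natl mulrA lexx.
pose c := vdot x y / vdot x x.
pose r i := y i - c * x i.
have rr : vdot r r = vdot y y - c ^+ 2 * vdot x x.
  have : vdot r r = vdot y y - c * vdot x y *+ 2 + c ^+ 2 * vdot x x.
    rewrite /vdot mulr_sumr -sumrMnl mulr_sumr -sumrN -!big_split/=.
    by apply: eq_bigr => i _; rewrite /r; ring.
  move=> ->; rewrite /c; field; by rewrite gt_eqF.
have rs : vdot r r < (eta * `|c| * `|x ord0|) ^+ 2.
  rewrite rr [ltRHS]exprMn [X in _ < X * _]exprMn !real_normK ?num_real//.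
  move: cxy; rewrite /cap => cxy.
  have cE : vdot x y ^+ 2 = c ^+ 2 * vdot x x ^+ 2.
    by rewrite -exprMn /c divfK// gt_eqF.
  move: cxy; rewrite cE.
  move: (vdot x x) (vdot y y) (x ord0 ^+ 2) X0 XA x02 => X Y q X0 XA q0 h.
  have h1 : A * Y < c ^+ 2 * X * (A + eta ^+ 2).
    move: h; rewrite mulrAC ltr_pdivrMr//.
    rewrite (_ : A * (X * Y) = X * (A * Y)); last by ring.
    by rewrite (_ : c ^+ 2 * X ^+ 2 * _ = X * (c ^+ 2 * X * (A + eta ^+ 2))) ?ltr_pM2l//; ring.
  have h2 : A * (Y - c ^+ 2 * X) < A * (eta ^+ 2 * c ^+ 2 * q).
    have := ler_wpM2l (mulr_ge0 (sqr_ge0 c) (ltW eta2)) XA.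
    move: (c ^+ 2) (eta ^+ 2) h1 => c2 e2 h1 h3.
    by nra.
  by move: h2; rewrite ltr_pM2l.
have ri i : `|r i| < eta * `|c| * `|x ord0|.
  have k0 : 0 <= eta * `|c| * `|x ord0| 
    by exact: (mulr_ge0 (mulr_ge0 (ltW eta0) (normr_ge0 _)) (normr_ge0 _)).
  rewrite -ltr_sqr ?nnegrE// real_normK ?num_real//.
  exact: le_lt_trans (sqr_coord_le r i) rs.
have yE i : y i = c * x i + r i by rewrite /r addrC subrK.
have cx0 : 0 <= `|c| * `|x ord0| by rewrite mulr_ge0.
have y0 : (1 - eta) * (`|c| * `|x ord0|) < `|y ord0|.
  have := ri ord0; rewrite yE => h.
  have := ler_normB (c * x ord0 + r ord0) (r ord0); rewrite addrK normrM.
  lra.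
apply/forallP => i.
have yi : `|y (lift ord0 i)| < (s + eta) * (`|c| * `|x ord0|).
  rewrite yE; apply: le_lt_trans (ler_normD _ _) _; rewrite normrM.
  have := ri (lift ord0 i).
  have : `|c| * `|x (lift ord0 i)| <= `|c| * (s * `|x ord0|).
    by apply: ler_wpM2l => //; rewrite ltW//; move/forallP: cx; exact.
  lra.
apply: lt_le_trans yi _.
rewrite (_ : s + eta = t * (1 - eta)); last by rewrite /eta; field; rewrite gt_eqF.
by rewrite -mulrA ler_wpM2l// ltW.
Qed.

Section two_vectors.
Context d1 d2 (T1 : measurableType d1) (T2 : measurableType d2)
  (P1 : probability T1 R) (P2 : probability T2 R) (m : nat)
  (V1 : T1 -> 'I_m -> R) (V2 : T2 -> 'I_m -> R).
Hypothesis mV1 : forall i, measurable_fun setT (fun x => V1 x i).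
Hypothesis mV2 : forall i, measurable_fun setT (fun x => V2 x i).

(** Integrating the second vector first, the cap around [V1 x] has the same probability
    for every [x] in [A]. *)
Lemma isotropic_integrate (rho : R) (e : 'I_m -> R) (A : set T1) :
  isotropic P2 V2 -> 0 < vdot e e ->
  measurable A -> (forall x, A x -> 0 < vdot (V1 x) (V1 x)) ->
  (prod_prob P1 P2 [set p | A p.1 /\ cap rho (V1 p.1) (V2 p.2)] =
   P2 [set y | cap rho e (V2 y)] * P1 A)%E.
Proof.
move=> iso e0 mA Agt0; rewrite prod_probE.
have mc : measurable [set y | cap rho e (V2 y)] by exact: measurable_cap.
rewrite (_ : P1 A = \int[P1]_x (\1_A x)%:E)%E; last by rewrite integral_indic// setIT.
rewrite -ge0_integralZl//; last first.
  by apply/measurable_EFinP; exact: measurable_indic.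
apply: eq_integral => x _; rewrite indicE.
have [/set_mem Ax|/negP nAx] := boolP (x \in A).
  rewrite mule1 -(iso rho _ _ (Agt0 _ Ax) e0); congr (P2 _).
  by apply/seteqP; split=> y /=; tauto.
rewrite mule0 (_ : [set y | _] = set0) ?measure0//.
by apply/seteqP; split=> y //= -[Ax]; exfalso; apply: nAx; rewrite inE.
Qed.

End two_vectors.

(** Two independent isotropic vectors [V1] and [V2] are compared through the event that
    they are close. Integrating out [V2] first, its probability is that of a cap for
    [V2]; integrating out [V1] first, it is that of a cap for [V1]; so these two numbers
    agree. The same computation restricted to [V1] in the cone [s], respectively [V2] in
    the cone [t], gives the two sides of the inequality, up to this common positive
    factor, because closeness to a vector of the cone [s] implies membership in the cone
    [t]. *)
Lemma isotropic_cone_le d1 d2 (T1 : measurableType d1) (T2 : measurableType d2)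
    (P1 : probability T1 R) (P2 : probability T2 R) (m : nat)
    (V1 : T1 -> 'I_m.+2 -> R) (V2 : T2 -> 'I_m.+2 -> R) (s t : R) :
  (forall i, measurable_fun setT (fun x => V1 x i)) ->
  (forall i, measurable_fun setT (fun x => V2 x i)) ->
  isotropic P1 V1 -> isotropic P2 V2 ->
  P1 [set x | 0 < vdot (V1 x) (V1 x)] = 1%E ->
  P2 [set x | 0 < vdot (V2 x) (V2 x)] = 1%E ->
  (forall rho e, 0 <= rho < 1 -> 0 < vdot e e ->
     (0 < P1 [set x | cap rho e (V1 x)])%E \/ (0 < P2 [set x | cap rho e (V2 x)])%E) ->
  0 <= s -> s < t ->
  (P1 [set x | cone s (V1 x)] <= P2 [set x | cone t (V2 x)])%E.
Proof.
move=> mV1 mV2 i1 i2 n1 n2 pos s0 st.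
have [rho [r0 r1 rP]] := cap_cone m s0 st.
pose e (i : 'I_m.+2) : R := (i == ord0)%:R.
have e0 : 0 < vdot e e.
  by apply: lt_le_trans (sqr_coord_le e ord0); rewrite /e eqxx expr1n.
have mV1' i : measurable_fun setT (fun p : T1 * T2 => V1 p.1 i).
  exact: (measurableT_comp (mV1 i) measurable_fst).
have mV2' i : measurable_fun setT (fun p : T1 * T2 => V2 p.2 i).
  exact: (measurableT_comp (mV2 i) measurable_snd).
have mcap : measurable [set p : T1 * T2 | cap rho (V1 p.1) (V2 p.2)].
  exact: measurable_cap.
have mpos1 : measurable [set x | 0 < vdot (V1 x) (V1 x)].
  by apply: measurable_set_ltr => //; exact: measurable_vdot.
have mpos2 : measurable [set x | 0 < vdot (V2 x) (V2 x)].
  by apply: measurable_set_ltr => //; exact: measurable_vdot.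
have mc1 := measurable_cone s mV1.
have mc2 := measurable_cone t mV2.
have cpos k (u : R) (v : 'I_k.+2 -> R) : cone u v -> 0 < vdot v v.
  move=> /cone_gt0 v0; apply: lt_le_trans (sqr_coord_le v ord0).
  by rewrite exprn_even_gt0.
have swap (A : set T2) : measurable A ->
    prod_prob P1 P2 [set p | A p.2 /\ cap rho (V1 p.1) (V2 p.2)] =
    prod_prob P2 P1 [set p | A p.1 /\ cap rho (V2 p.1) (V1 p.2)].
  move=> mA; rewrite prod_probEr.
    rewrite prod_probE; apply: eq_integral => y _; congr (P1 _).
    by apply/seteqP; split => x /=; rewrite capC.
  apply: measurableI => //.
  have mA2 : measurable (@snd T1 T2 @^-1` A) by rewrite -[X in measurable X]setTI; exact: measurable_snd.
  exact: mA2.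
pose a1 := P1 [set x | cap rho e (V1 x)].
pose a2 := P2 [set x | cap rho e (V2 x)].
pose S := [set p : T1 * T2 | cap rho (V1 p.1) (V2 p.2)].
have I12 A := @isotropic_integrate _ _ T1 T2 P1 P2 _ V1 V2 mV2 rho e A i2 e0.
have I21 A := @isotropic_integrate _ _ T2 T1 P2 P1 _ V2 V1 mV1 rho e A i1 e0.
have S2 : prod_prob P1 P2 S = a2.
  transitivity (a2 * P1 [set x | 0 < vdot (V1 x) (V1 x)]%R)%E; last by rewrite n1 mule1.
  rewrite -I12//; congr (prod_prob _ _ _).
  by apply/seteqP; split=> p /=; [move=> h; split=> //; exact: cap_gt0 h|case].
have S1 : prod_prob P1 P2 S = a1.
  transitivity (a1 * P2 [set x | 0 < vdot (V2 x) (V2 x)]%R)%E; last by rewrite n2 mule1.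
  rewrite -I21// -swap//; congr (prod_prob _ _ _).
  apply/seteqP; split=> p /=; last by case.
  by move=> h; split=> //; move: h; rewrite /S /= capC; exact: cap_gt0.
have a12 : a1 = a2 by rewrite -S1 S2.
have a10 : (0 < a1)%E.
  by have [|//|] := pos rho e _ e0; [rewrite r0|rewrite a12].
have a1fin : a1 \is a fin_num by apply: fin_num_measure; exact: measurable_cap.
rewrite -(lee_pmul2l a1fin a10) {1}a12 -I12//; last by move=> x; exact: cpos.
rewrite -I21//; last by move=> x; exact: cpos.
rewrite -swap//; apply: le_measure; rewrite ?inE.
- apply: measurableI => //.
  have mA1 : measurable (@fst T1 T2 @^-1` [set x | cone s (V1 x)]).
    by rewrite -[X in measurable X]setTI; exact: measurable_fst.
  exact: mA1.
- apply: measurableI => //.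
  have mA2 : measurable (@snd T1 T2 @^-1` [set x | cone t (V2 x)]).
    by rewrite -[X in measurable X]setTI; exact: measurable_snd.
  exact: mA2.
by move=> p /= [cs cc]; split => //; exact: rP cs cc.
Qed.

End isotropic_uniqueness.

Section isotropic_bounds.
Context {R : realType}.
Local Notation RM := (measurableTypeR R).

Lemma gauss_set1 (x : R) : gauss [set x] = 0%E.
Proof.
apply: (null_content_dominatesP gauss lebesgue_measure).1 => //.
  exact: normal_prob_dominates.
exact: lebesgue_measure_set1.
Qed.

Lemma gaussT_neq0 m : gaussT m.+1 [set W : m.+1.-tuple RM | 0 < vdot (tnth W) (tnth W)] = 1%E.
Proof.
have mA : measurable [set W : m.+1.-tuple RM | 0 < vdot (tnth W) (tnth W)].
  by apply: measurable_set_ltr => //; apply: measurable_vdot => i; exact: measurable_tnthR.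
have : gaussT m.+1 (~` [set W : m.+1.-tuple RM | 0 < vdot (tnth W) (tnth W)]) = 0%E.
  set A := ~` _; pose c := gaussT m [set W | A (cons_tuple (0 : R) W)].
  transitivity (c * gauss [set (0%R : RM)])%E; last by rewrite gauss_set1 mule0.
  rewrite gaussTS.
  rewrite (_ : gauss [set 0%R] = \int[gauss]_w (\1_[set (0%R : RM)] w)%:E)%E; last first.
    by rewrite integral_indic// setIT.
  rewrite -ge0_integralZl//; last 2 first.
  - by apply/measurable_EFinP; exact: measurable_indic.
  - exact: measure_ge0.
  apply: eq_integral => w _; rewrite indicE; have [->|w0] := eqVneq w 0.
    by rewrite mem_set// mule1.
  rewrite memNset; last exact/eqP.
  rewrite mule0 (_ : [set W | _] = set0) ?measure0//.
  apply/seteqP; split=> W //=; rewrite /A /= sqnormS; apply.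
  by rewrite ltr_pwDl ?vdot_ge0// exprn_even_gt0.
have fA := fin_num_measure (gaussT m.+1) _ mA.
rewrite probability_setC// -(fineK fA) -EFinB => -[/eqP].
by rewrite subr_eq0 => /eqP <-.
Qed.

(** Serves to let the aperture of a cone increase to its final value. *)
Lemma le_left_limit (F : R -> R) (t p : R) : 0 < t -> {for t, continuous F} ->
  (forall s, 0 < s -> s < t -> F s <= p) -> F t <= p.
Proof.
move=> t0 cF H; rewrite leNgt; apply/negP => pF.
have : \forall s \near t^'-, [/\ p < F s, 0 < s & s < t].
  near=> s; split; near: s.
  - have cF' : F s @[s --> t^'-] --> F t by apply: cvg_at_left_filter; exact: cF.
    exact: (cvgr_gt (F t) cF').
  - exact: nbhs_left_gt.
  - exact: nbhs_left_lt.
move=> /(@filter_ex _ _ (at_left_proper_filter t))[s [pFs s0 st]].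
by have := H s s0 st; rewrite leNgt pFs.
Unshelve. all: by end_near. Qed.

Lemma ge_right_limit (F : R -> R) (t p : R) : {for t, continuous F} ->
  (forall s, t < s -> p <= F s) -> p <= F t.
Proof.
move=> cF H; rewrite leNgt; apply/negP => pF.
have : \forall s \near t^'+, F s < p /\ t < s.
  near=> s; split; near: s.
  - have cF' : F s @[s --> t^'+] --> F t by apply: cvg_at_right_filter; exact: cF.
    exact: (cvgr_lt (F t) cF').
  - exact: nbhs_right_gt.
move=> /(@filter_ex _ _ (at_right_proper_filter t))[s [pFs ts]].
by have := H s ts; rewrite leNgt pFs.
Unshelve. all: by end_near. Qed.

Context d (T : measurableType d) (P : probability T R).

(** Comparison with a Gaussian vector for each [s < t], followed by [s --> t]. *)
Lemma isotropic_cone_ge m (V : T -> 'I_m.+2 -> R) (t : R) :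
  (forall i, measurable_fun setT (fun x => V x i)) -> isotropic P V ->
  P [set x | 0 < vdot (V x) (V x)] = 1%E -> 0 < t ->
  (((2 / pi * atan t) ^+ m.+1)%:E <= P [set x | cone t (V x)])%E.
Proof.
move=> mV iV V0 t0.
have mC := measurable_cone t mV.
rewrite -(fineK (fin_num_measure P _ mC)) lee_fin.
apply: (@le_left_limit (fun s => (2 / pi * atan s) ^+ m.+1)) => //.
  apply: (@continuous_comp _ _ _ (fun s => 2 / pi * atan s) (fun x => x ^+ m.+1)).
    by apply: cvgM; [exact: cvg_cst|exact: continuous_atan].
  exact: exprn_continuous.
move=> s s0 st; rewrite -lee_fin fineK; last exact: fin_num_measure.
apply: le_trans (gaussT_cone_ge m s0) _.
apply: (isotropic_cone_le _ mV (gaussT_isotropic (m:=m.+2)) iV (gaussT_neq0 m.+1) V0 _ (ltW s0) st).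
  exact: measurable_tnthR.
by move=> rho e /andP[r0 r1] e0; left; exact: gaussT_cap_gt0.
Qed.

Lemma isotropic_cone1_le (V : T -> 'I_2 -> R) (s t : R) :
  (forall i, measurable_fun setT (fun x => V x i)) -> isotropic P V ->
  P [set x | 0 < vdot (V x) (V x)] = 1%E -> 0 <= s -> s < t ->
  (P [set x | cone s (V x)] <= (2 / pi * atan t)%:E)%E.
Proof.
move=> mV iV V0 s0 st.
rewrite -gaussT_cone1; last exact: le_lt_trans st.
apply: (isotropic_cone_le mV _ iV (gaussT_isotropic (m:=2)) V0 (gaussT_neq0 1) _ s0 st).
  exact: measurable_tnthR.
by move=> rho e /andP[r0 r1] e0; right; exact: gaussT_cap_gt0.
Qed.

End isotropic_bounds.

(** * Measurability on the space of matrices, null sets *)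

Section borel_matrix.
Context {R : realType} {n : nat}.

Lemma measurable_coord (i j : 'I_n) :
  measurable_fun setT (fun g : borel_matrix R n => (g : 'M[R]_n) i j).
Proof.
apply: (measurability _ (RGenOpens.measurableE R)).
move=> _ [_ [a [b ->]] <-]; rewrite setTI; apply: sub_sigma_algebra.
apply: (@open_comp _ _ (fun g : 'M[R]_n => g i j)); last exact: interval_open.
move=> g _; exact: coord_continuous.
Qed.

(** Entrywise measurability suffices for the polynomial functions of the entries used
    below, and it requires no sigma-algebra on rectangular matrices. *)
Definition mx_measurable d (T : measurableType d) p q (f : T -> 'M[R]_(p, q)) : Prop :=
  forall i j, measurable_fun setT (fun t => f t i j).

Lemma mx_measurable_id : mx_measurable (fun g : borel_matrix R n => (g : 'M[R]_n)).
Proof. exact: measurable_coord. Qed.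

End borel_matrix.

Section mx_measurable_theory.
Context {R : realType} d (T : measurableType d).

Lemma mx_measurable_cst p q (M : 'M[R]_(p, q)) : mx_measurable (fun _ : T => M).
Proof. by move=> i j. Qed.

Lemma mx_measurableM p q r (f : T -> 'M[R]_(p, q)) (g : T -> 'M[R]_(q, r)) :
  mx_measurable f -> mx_measurable g -> mx_measurable (fun t => f t *m g t).
Proof.
move=> mf mg i j; rewrite (_ : (fun _ => _) = fun t => \sum_l f t i l * g t l j).
  by apply: measurable_sum => l; exact: measurable_funM.
by apply/funext => t; rewrite mxE.
Qed.

Lemma mx_measurable_tr p q (f : T -> 'M[R]_(p, q)) :
  mx_measurable f -> mx_measurable (fun t => (f t)^T).
Proof.
move=> mf i j; rewrite (_ : (fun _ => _) = fun t => f t j i); first exact: mf.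
by apply/funext => t; rewrite mxE.
Qed.

Lemma mx_measurable_det p (f : T -> 'M[R]_p) :
  mx_measurable f -> measurable_fun setT (fun t => \det (f t)).
Proof.
move=> mf; apply: measurable_sum => s; apply: measurable_funM => //.
by apply: measurable_prod => i _; exact: mf.
Qed.

Lemma mx_measurable_adj p (f : T -> 'M[R]_p) :
  mx_measurable f -> mx_measurable (fun t => \adj (f t)).
Proof.
move=> mf i j.
rewrite (_ : (fun _ => _) = fun t => (-1) ^+ (j + i) * \det (row' j (col' i (f t)))).
  apply: measurable_funM => //; apply: mx_measurable_det => a b.
  rewrite (_ : (fun _ => _) = fun t => f t (lift j a) (lift i b)); first exact: mf.
  by apply/funext => t; rewrite !mxE.
by apply/funext => t; rewrite mxE.
Qed.

Lemma mx_measurable_eq p q (f g : T -> 'M[R]_(p, q)) :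
  mx_measurable f -> mx_measurable g -> measurable [set t | f t = g t].
Proof.
move=> mf mg; rewrite (_ : [set t | _] = [set t | [forall i, [forall j, f t i j == g t i j]]]).
  do 2 apply: measurable_set_forall => ?.
  by apply: measurable_set_bool; exact: measurable_fun_eqr.
apply/seteqP; split=> t /=; first by move=> ->; do 2 apply/forallP => ?.
move=> /forallP h; apply/matrixP => i j; exact/eqP/(forallP (h i)).
Qed.

End mx_measurable_theory.

Section haar.
Context {R : realType} {n : nat} (mu : probability (borel_matrix R n) R).
Hypothesis haar : normalized_haar mu.

(** The invariance in [normalized_haar] is stated for images; the image by [h] of a
    preimage by [h] is the set itself. *)
Lemma haar_preimage (h : 'M[R]_n) (A : set (borel_matrix R n)) :
  orthogonal_group R n h -> measurable A ->
  measurable [set g : (borel_matrix R n) | A (h *m (g : 'M[R]_n))] ->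
  mu [set g : (borel_matrix R n) | A (h *m (g : 'M[R]_n))] = mu A.
Proof.
move=> hO mA mhA; rewrite -(haar.2 h hO _ mhA); congr (mu _).
have hU : h *m h^T = 1%:M by apply: mulmx1C.
apply/seteqP; split=> g /=; first by case=> g' Ag' <-.
move=> Ag; exists (h^T *m g); last by rewrite mulmxA hU mul1mx.
by rewrite /= mulmxA hU mul1mx.
Qed.

Lemma measurable_orthogonal_group : measurable (orthogonal_group R n : set (borel_matrix R n)).
Proof.
apply: mx_measurable_eq; last exact: mx_measurable_cst.
exact: (mx_measurableM (mx_measurable_tr mx_measurable_id) mx_measurable_id).
Qed.

End haar.

Section null_sets.
Context {R : realType} d (T : measurableType d) (P : probability T R).

Lemma measure_eq_off_null (N A B : set T) :
  measurable N -> measurable A -> measurable B -> P N = 0%E ->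
  (forall x, ~ N x -> A x <-> B x) -> P A = P B.
Proof.
move=> mN mA mB N0.
suff le (C D : set T) : measurable C -> measurable D ->
    (forall x, ~ N x -> C x -> D x) -> (P C <= P D)%E.
  by move=> h; apply/eqP; rewrite eq_le !le// => x Nx /(h x Nx).
move=> mC mD h; apply: (@le_trans _ _ (P (D `|` N))).
  apply: le_measure; rewrite ?inE//; first exact: measurableU.
  by move=> x Cx; have [Nx|Nx] := pselect (N x); [right|left; exact: h].
rewrite -[leRHS]adde0 -N0; exact: measureU2.
Qed.

Lemma prob_null_setU (A B : set T) : measurable A -> measurable B ->
  P A = 0%E -> P B = 0%E -> P (A `|` B) = 0%E.
Proof.
move=> mA mB A0 B0; apply/eqP; rewrite eq_le measure_ge0 andbT.
rewrite -[leRHS]adde0 -{1}A0 -B0; exact: measureU2.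
Qed.

Lemma prob_null_subset (A B : set T) : measurable A -> measurable B -> A `<=` B ->
  P B = 0%E -> P A = 0%E.
Proof.
move=> mA mB AB B0; apply/eqP; rewrite eq_le measure_ge0 andbT -B0.
by apply: le_measure; rewrite ?inE.
Qed.

(** [N] disjoint sets of measure [c] force [N * c <= 1], for every [N]. *)
Lemma disjoint_equimeasure_null (A : nat -> set T) (c : \bar R) :
  (forall i, measurable (A i)) -> trivIset setT A ->
  (forall i, P (A i) = c) -> c = 0%E.
Proof.
move=> mA tA PA.
have cfin : c \is a fin_num by rewrite -(PA 0%N) fin_num_measure.
have c0 : (0 <= c)%E by rewrite -(PA 0%N).
have le1 (N : nat) : N%:R * fine c <= 1.
  have : (P (\big[setU/set0]_(i < N) A i) <= 1)%E.
    by apply: probability_le1; exact: bigsetU_measurable.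
  rewrite measure_bigsetU// (eq_bigr (fun=> (fine c)%:E)); last by move=> i _; rewrite fineK//; exact: PA.
  by rewrite sumEFin lee_fin sumr_const card_ord mulr_natl.
rewrite -(fineK cfin); congr EFin; apply/eqP; rewrite eq_le fine_ge0// andbT leNgt.
apply/negP => cpos.
have := le1 (Num.bound (fine c)^-1).
rewrite leNgt => /negP; apply.
by rewrite -ltr_pdivrMr// mul1r; apply: archi_boundP; rewrite invr_ge0 ltW.
Qed.

End null_sets.

(** * Reflections *)

Section reflection.
Context {R : realType} {n : nat}.
Implicit Types v x y : 'cV[R]_n.

Lemma dotE v x : v^T *m x = (dot v x)%:M.
Proof.
apply/matrixP => i j; rewrite !ord1 !mxE eqxx mulr1n; apply: eq_bigr => l _.
by rewrite mxE.
Qed.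

Lemma dotC v x : dot v x = dot x v.
Proof. by apply: eq_bigr => i _; rewrite mulrC. Qed.

Lemma dotDr v x y : dot v (x + y) = dot v x + dot v y.
Proof. by rewrite /dot -big_split; apply: eq_bigr => i _; rewrite !mxE mulrDr. Qed.

Lemma dotZr v (c : R) x : dot v (c *: x) = c * dot v x.
Proof. by rewrite /dot mulr_sumr; apply: eq_bigr => i _; rewrite !mxE mulrCA. Qed.

Lemma dotNr v x : dot v (- x) = - dot v x.
Proof. by rewrite -scaleN1r dotZr mulN1r. Qed.

Lemma dotBr v x y : dot v (x - y) = dot v x - dot v y.
Proof. by rewrite dotDr dotNr. Qed.

Lemma dotBl v x y : dot (x - y) v = dot x v - dot y v.
Proof. by rewrite dotC dotBr !(dotC v). Qed.

Lemma dotZl v (c : R) x : dot (c *: x) v = c * dot x v.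
Proof. by rewrite dotC dotZr (dotC v). Qed.

Lemma dot_eq0 x : dot x x = 0 -> x = 0.
Proof.
move=> /eqP; rewrite psumr_eq0 => [/allP h|i _]; last by rewrite -expr2 sqr_ge0.
apply/matrixP => i j; rewrite ord1 mxE; apply/eqP.
by have := h i; rewrite mem_index_enum mulf_eq0 orbb; apply.
Qed.

Lemma dot_orthogonal (h : 'M[R]_n) x y : orthogonal_group R n h ->
  dot (h *m x) (h *m y) = dot x y.
Proof.
move=> hO; have : (h *m x)^T *m (h *m y) = x^T *m y.
  by rewrite trmx_mul mulmxA -(mulmxA x^T) hO mulmx1.
by rewrite !dotE => /matrixP/(_ 0 0); rewrite !mxE eqxx !mulr1n.
Qed.

Definition reflection v : 'M[R]_n := 1%:M - (2 / dot v v) *: (v *m v^T).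

Lemma reflectionE v x : reflection v *m x = x - (2 * dot v x / dot v v) *: v.
Proof.
rewrite /reflection mulmxBl mul1mx -scalemxAl -mulmxA dotE mul_mx_scalar scalerA.
by rewrite mulrAC.
Qed.

Lemma reflection_orthogonal v : dot v v != 0 -> orthogonal_group R n (reflection v).
Proof.
move=> v0; rewrite /orthogonal_group /=.
have -> : (reflection v)^T = reflection v.
  by rewrite /reflection linearB /= trmx1 linearZ /= trmx_mul trmxK.
suff H x : reflection v *m (reflection v *m x) = x.
  apply/matrixP => i j; rewrite -[LHS]/((reflection v *m reflection v) i j).
  have := H (delta_mx j 0); rewrite mulmxA -!colE => /matrixP/(_ i 0).
  by rewrite !mxE eqxx andbT.
rewrite !reflectionE dotBr dotZr -addrA -opprD -scalerDl.
rewrite [X in X *: _](_ : _ = 0) ?scale0r ?subr0//.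
by field.
Qed.

(** Two vectors of the same norm are exchanged by the reflection in the hyperplane
    orthogonal to their difference: this gives enough orthogonal matrices to move any
    direction to any other. *)
Lemma reflection_swap x y : dot x x = dot y y -> dot (x - y) (x - y) != 0 ->
  reflection (x - y) *m x = y.
Proof.
move=> xy xy0; rewrite reflectionE.
have E : dot (x - y) (x - y) = 2 * dot (x - y) x.
  rewrite dotBr !dotBl (dotC y x) -xy; ring.
by rewrite -E divff// scale1r opprB addrCA subrr addr0.
Qed.

Lemma reflection_mulmxE m v (g : 'M[R]_(n, m)) i l :
  (reflection v *m g) i l = g i l - 2 / dot v v * v i 0 * \sum_j v j 0 * g j l.
Proof.
have -> : (reflection v *m g) i l = (reflection v *m col l g) i 0.
  by rewrite colE mulmxA -colE [RHS]mxE.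
rewrite reflectionE !mxE /dot.
rewrite (eq_bigr (fun j => v j 0 * g j l)); last by move=> j _; rewrite mxE.
by congr (_ - _); ring.
Qed.

End reflection.

(** * The leading minor of a Haar matrix is almost surely nonzero *)

Section minor.
Context {R : realType} {k d : nat}.
Implicit Types g : 'M[R]_(k + d).

(** Its nonvanishing says that the span of the first [k] columns of [g] projects
    isomorphically onto the first [k] coordinates. *)
Definition minor g : R := \det (ulsubmx g).

Lemma minor_row_linear g g1 g2 (p : 'I_k) (c s : R) :
  (forall l, g (lshift d p) l = c * g1 (lshift d p) l + s * g2 (lshift d p) l) ->
  (forall i l, i != p -> g1 (lshift d i) l = g (lshift d i) l) ->
  (forall i l, i != p -> g2 (lshift d i) l = g (lshift d i) l) ->
  minor g = c * minor g1 + s * minor g2.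
Proof.
move=> gp g1E g2E; apply: (determinant_multilinear (i0 := p)).
- by apply/rowP => l; rewrite !mxE gp.
- by apply/matrixP => i l; rewrite !mxE g1E// eq_sym neq_lift.
- by apply/matrixP => i l; rewrite !mxE g2E// eq_sym neq_lift.
Qed.

(** [e_p + j e_q]: as [j] varies, the reflections in these vectors form an infinite
    family of orthogonal matrices that act in the plane of the coordinates [p] and [q]
    only. *)
Definition plane_vec (p q : 'I_(k + d)) (j : nat) : 'cV[R]_(k + d) :=
  \col_i ((i == p)%:R + j%:R * (i == q)%:R).

Lemma sum_plane_vec p q j (F : 'I_(k + d) -> R) :
  \sum_i plane_vec p q j i 0 * F i = F p + j%:R * F q.
Proof.
rewrite (eq_bigr (fun i => (i == p)%:R * F i + j%:R * ((i == q)%:R * F i))); last first.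
  by move=> i _; rewrite mxE; ring.
rewrite big_split/= -mulr_sumr.
have pick r : \sum_i (i == r)%:R * F i = F r.
  by rewrite (bigD1 r)//= eqxx mul1r big1 ?addr0// => i /negbTE ->; rewrite mul0r.
by rewrite !pick.
Qed.

Lemma dot_plane_vec p q j : p != q -> dot (plane_vec p q j) (plane_vec p q j) = 1 + j%:R ^+ 2.
Proof.
move=> pq; have /negbTE qp : q != p by rewrite eq_sym.
rewrite /dot sum_plane_vec !mxE !eqxx (negbTE pq) qp /=.
by ring.
Qed.

Definition pcos (j : nat) : R := (j%:R ^+ 2 - 1) / (1 + j%:R ^+ 2).
Definition psin (j : nat) : R := - (j%:R *+ 2) / (1 + j%:R ^+ 2).

Let den_neq0 j : 1 + j%:R ^+ 2 != 0 :> R.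
Proof. by rewrite gt_eqF// ltr_pwDl// sqr_ge0. Qed.

(** The first rows of two of these reflections are linearly independent. *)
Lemma pcos_psin_det j j' : j != j' -> pcos j * psin j' - pcos j' * psin j != 0.
Proof.
move=> jj'.
have -> : pcos j * psin j' - pcos j' * psin j =
    2 * (j%:R - j'%:R) * - (1 + j%:R * j'%:R) / ((1 + j%:R ^+ 2) * (1 + j'%:R ^+ 2)).
  by rewrite /pcos /psin; field; rewrite !den_neq0.
apply: mulf_neq0; last by rewrite invr_neq0// mulf_neq0.
apply: mulf_neq0; last by rewrite oppr_eq0 gt_eqF// ltr_pwDl// mulr_ge0.
by rewrite mulf_neq0// subr_eq0 eqr_nat.
Qed.

Section plane_reflection.
Variables (p : 'I_k) (q : 'I_d).
Let P := lshift d p.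
Let Q := rshift k q.

Let PQ : P != Q.
Proof. by rewrite eq_lrshift. Qed.

Let refl j := reflection (plane_vec P Q j).

Let reflP j g l : (refl j *m g) P l = pcos j * g P l + psin j * g Q l.
Proof.
rewrite reflection_mulmxE sum_plane_vec dot_plane_vec// mxE eqxx (negbTE PQ) /=.
by rewrite /pcos /psin; field.
Qed.

Let reflQ j g l : (refl j *m g) Q l = psin j * g P l - pcos j * g Q l.
Proof.
rewrite reflection_mulmxE sum_plane_vec dot_plane_vec// mxE eqxx eq_sym (negbTE PQ).
by rewrite /= /pcos /psin; field.
Qed.

Let reflN j g i l : i != P -> i != Q -> (refl j *m g) i l = g i l.
Proof.
move=> iP iQ; rewrite reflection_mulmxE mxE (negbTE iP) (negbTE iQ).
by rewrite /=; ring.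
Qed.

Let upP (i : 'I_k) : i != p -> lshift d i != P.
Proof. by rewrite eq_lshift. Qed.

Let upQ (i : 'I_k) : lshift d i != Q.
Proof. by rewrite eq_lrshift. Qed.

(** The minor is linear in its row [p], and the reflection replaces that row by a
    combination of the rows [p] and [q]. *)
Lemma minor_plane_reflection j g :
  minor (reflection (plane_vec (lshift d p) (rshift k q) j) *m g) =
  pcos j * minor g + psin j * minor (xrow (lshift d p) (rshift k q) g).
Proof.
apply: (minor_row_linear (p := p)).
- by move=> l; rewrite (reflP j g l) [in RHS]mxE tpermL.
- by move=> i l ip; rewrite (reflN j g l (upP ip) (upQ i)).
- move=> i l ip; rewrite (reflN j g l (upP ip) (upQ i)) mxE tpermD// eq_sym ?(upP ip)//.
Qed.

Lemma minor_plane_reflection_swap j g :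
  minor (xrow (lshift d p) (rshift k q) (reflection (plane_vec (lshift d p) (rshift k q) j) *m g)) =
  psin j * minor g - pcos j * minor (xrow (lshift d p) (rshift k q) g).
Proof.
rewrite -mulNr; apply: (minor_row_linear (p := p)).
- by move=> l; rewrite [LHS]mxE tpermL (reflQ j g l) mulNr [in RHS]mxE tpermL.
- move=> i l ip; rewrite [RHS]mxE tpermD ?(reflN j g l (upP ip) (upQ i))// eq_sym ?(upP ip)//.
- move=> i l ip; rewrite [LHS]mxE [RHS]mxE tpermD; last 2 first.
  + by rewrite eq_sym (upP ip).
  + by rewrite eq_sym (upQ i).
  by rewrite (reflN j g l (upP ip) (upQ i)).
Qed.

End plane_reflection.

Section haar.
Variable mu : probability (borel_matrix R (k + d)) R.
Hypothesis haar : normalized_haar mu.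
Local Notation BM := (borel_matrix R (k + d)).

Lemma measurable_minor d0 (T : measurableType d0) (f : T -> 'M[R]_(k + d)) :
  mx_measurable f -> measurable_fun setT (fun t => minor (f t)).
Proof.
move=> mf; apply: mx_measurable_det => i j.
rewrite (_ : (fun _ => _) = fun t => f t (lshift d i) (lshift d j)); first exact: mf.
by apply/funext => t; rewrite !mxE.
Qed.

Lemma measurable_minor_exchange d0 (T : measurableType d0) (f f' : T -> 'M[R]_(k + d)) :
  mx_measurable f -> mx_measurable f' ->
  measurable [set t | (minor (f t) == 0) && (minor (f' t) != 0)].
Proof.
move=> mf mf'; apply: measurable_set_bool; apply: measurable_and.
  by apply: measurable_fun_eqr => //; exact: measurable_minor.
by apply: measurable_neg; apply: measurable_fun_eqr => //; exact: measurable_minor.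
Qed.

Lemma mx_measurable_row_perm d0 (T : measurableType d0) (s : {perm 'I_(k + d)})
  (f : T -> 'M[R]_(k + d)) : mx_measurable f -> mx_measurable (fun t => row_perm s (f t)).
Proof.
move=> mf i j; rewrite (_ : (fun _ => _) = fun t => f t (s i) j); first exact: mf.
by apply/funext => t; rewrite mxE.
Qed.

(** The pair formed by the minor and the minor with rows [p] and [q] exchanged is
    transformed linearly by the reflections in [plane_vec P Q j]. The preimages of the
    event by these reflections all have the same measure, and they are disjoint, since a
    nonzero pair annihilated by two independent linear forms does not exist. Hence the
    event is null. *)
Lemma minor_exchange_null_lr (p : 'I_k) (q : 'I_d) :
  mu [set g : BM | (minor g == 0) && (minor (xrow (lshift d p) (rshift k q) g) != 0)] = 0%E.
Proof.
set A := [set g | _].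
pose h j := reflection (plane_vec (lshift d p) (rshift k q) j).
have mA : measurable A.
  by apply: measurable_minor_exchange; [|apply: mx_measurable_row_perm]; exact: mx_measurable_id.
have mhA j : measurable [set g : BM | A (h j *m (g : 'M[R]_(k + d)))].
  have mh : mx_measurable (fun g : BM => h j *m (g : 'M[R]_(k + d))).
    by apply: mx_measurableM; [exact: mx_measurable_cst|exact: mx_measurable_id].
  by apply: measurable_minor_exchange => //; apply: mx_measurable_row_perm.
apply: (disjoint_equimeasure_null (P := mu) (A := fun j => [set g : BM | A (h j *m (g : 'M[R]_(k + d)))])) => //.
- apply/trivIsetP => i j _ _ ij; apply/seteqP; split => // g [].
  rewrite /A /= !minor_plane_reflection !minor_plane_reflection_swap.
  move=> /andP[/eqP i0 in0] /andP[/eqP j0 _].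
  have D0 := pcos_psin_det ij.
  set a := minor g in i0 in0 j0; set b := minor _ in i0 in0 j0.
  have b0 : b = 0.
    apply: (mulfI D0); rewrite mulr0.
    rewrite (_ : _ * b = pcos i * (pcos j * a + psin j * b) - pcos j * (pcos i * a + psin i * b)).
      by rewrite i0 j0 !mulr0 subrr.
    by ring.
  have a0 : a = 0.
    apply: (mulfI D0); rewrite mulr0.
    rewrite (_ : _ * a = psin j * (pcos i * a + psin i * b) - psin i * (pcos j * a + psin j * b)).
      by rewrite i0 j0 !mulr0 subrr.
    by ring.
  by move: in0; rewrite a0 b0 !mulr0 subrr eqxx.
- move=> j; apply: (haar_preimage haar) => //.
  by apply: reflection_orthogonal; rewrite dot_plane_vec ?den_neq0// eq_lrshift.
Qed.

End haar.

End minor.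

(** List the values of [f] first and then the remaining indices. *)
Lemma perm_extending_inj (k d : nat) (f : 'I_k -> 'I_(k + d)) : injective f ->
  exists s : {perm 'I_(k + d)}, forall i, s (lshift d i) = f i.
Proof.
move=> fI.
pose c := [seq j <- enum 'I_(k + d) | j \notin codom f].
have uf : uniq (codom f) by apply/injectiveP.
have ul : uniq (codom f ++ c).
  rewrite cat_uniq uf filter_uniq ?enum_uniq// andbT /=.
  by apply/hasPn => j; rewrite mem_filter => /andP[].
have sl : size (codom f ++ c) = (k + d)%N.
  rewrite -[RHS]card_ord -(card_uniqP ul); apply: eq_card => j.
  by rewrite mem_cat mem_filter mem_enum inE andbT orbN.
pose t : (k + d).-tuple 'I_(k + d) := Tuple (introT eqP sl).
have tI : injective (tnth t).
  by apply/tuple_uniqP.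
exists (perm tI) => i; rewrite permE (tnth_nth (f i)) /= nth_cat size_codom card_ord ltn_ord.
by rewrite codomE (nth_map i) ?size_enum_ord// nth_ord_enum.
Qed.

(** The first [k] columns of an invertible matrix have rank [k], so some [k] of their
    rows are independent. *)
Lemma orthogonal_minor_neq0 (R : realType) (k d : nat) (g : 'M[R]_(k + d)) :
  orthogonal_group R (k + d) g ->
  exists s : {perm 'I_(k + d)}, minor (row_perm s g) != 0.
Proof.
move=> gO.
have gU : g \in unitmx by have /mulmx1_unit[] := gO.
have rf : row_full (lsubmx g).
  rewrite -col_leq_rank -mxrank_tr.
  have : row_free (g^T) by rewrite row_free_unit unitmx_tr.
  rewrite -(hsubmxK g) tr_row_mx /row_free => /eqP h.
  have le : (\rank (col_mx (lsubmx g)^T (rsubmx g)^T) <= \rank (lsubmx g)^T + \rank (rsubmx g)^T)%N.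
    by rewrite -addsmxE; exact: mxrank_adds_leqif.
  rewrite h in le; rewrite -(leq_add2r d) (leq_trans le)//.
  by rewrite hsubmxK leq_add2l rank_leq_row.
have [s sE] := perm_extending_inj (@fullrankfun_inj _ _ _ _ rf).
exists s.
have -> : minor (row_perm s g) = \det (rowsub (fullrankfun rf) (lsubmx g)).
  by congr (\det _); apply/matrixP => i j; rewrite !mxE sE.
by have := fullrowsub_unit rf; rewrite unitmxE unitfE.
Qed.

Section minor_null.
Context {R : realType} {k d : nat} (mu : probability (borel_matrix R (k + d)) R).
Hypothesis haar : normalized_haar mu.
Local Notation BM := (borel_matrix R (k + d)).

Lemma minor_exchange_null (p q : 'I_(k + d)) :
  mu [set g : BM | (minor g == 0) && (minor (xrow p q g) != 0)] = 0%E.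
Proof.
have trivial : (forall g : 'M[R]_(k + d), minor g = 0 -> minor (xrow p q g) = 0) ->
    mu [set g : BM | (minor g == 0) && (minor (xrow p q g) != 0)] = 0%E.
  move=> h; rewrite (_ : [set g | _] = set0) ?measure0//.
  by apply/seteqP; split=> g //= /andP[/eqP/h ->]; rewrite eqxx.
case: (split_ordP p) trivial => p' ->; case: (split_ordP q) => q' -> trivial.
- apply: trivial => g g0; rewrite /minor.
  have -> : ulsubmx (xrow (lshift d p') (lshift d q') g) = xrow p' q' (ulsubmx g).
    apply/matrixP => i j; rewrite !mxE; congr (g _ _).
    have [->|ip] := eqVneq i p'; first by rewrite !tpermL.
    have [->|iq] := eqVneq i q'; first by rewrite !tpermR.
    by rewrite !tpermD// ?eq_lshift eq_sym.
  by rewrite xrowE det_mulmx -/(minor g) g0 mulr0.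
- exact: minor_exchange_null_lr.
- rewrite -(minor_exchange_null_lr haar q' p'); congr (mu _).
  by rewrite /xrow tpermC.
- apply: trivial => g g0; rewrite -g0; congr (\det _); apply/matrixP => i j; rewrite !mxE.
  by rewrite tpermD// eq_rlshift.
Qed.

Lemma perm_mx_orthogonal (s : {perm 'I_(k + d)}) :
  orthogonal_group R (k + d) (perm_mx s).
Proof. by rewrite /orthogonal_group /= tr_perm_mx -perm_mxM mulVg perm_mx1. Qed.

(** Permutations are products of transpositions, and left multiplication by a
    permutation matrix preserves the measure. *)
Lemma minor_perm_null (s : {perm 'I_(k + d)}) :
  mu [set g : BM | (minor g == 0) && (minor (row_perm s g) != 0)] = 0%E.
Proof.
have [ts -> _] := prod_tpermP s.
elim/last_ind: ts => [|ts t IH].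
  rewrite big_nil (_ : [set g | _] = set0) ?measure0//.
  by apply/seteqP; split=> g //=; rewrite row_perm1 => /andP[->].
have mM (s' : {perm 'I_(k + d)}) (f : BM -> 'M[R]_(k + d)) : mx_measurable f ->
    measurable [set g : BM | (minor (f g) == 0) && (minor (row_perm s' (f g)) != 0)].
  by move=> mf; apply: measurable_minor_exchange => //; exact: mx_measurable_row_perm.
rewrite -cats1 big_cat big_seq1 /=; set s1 := (\prod_(t <- ts) tperm t.1 t.2)%g in IH *.
set t1 := tperm _ _.
have mt : mx_measurable (fun g : BM => row_perm t1 (g : 'M[R]_(k + d))).
  by apply: mx_measurable_row_perm; exact: mx_measurable_id.
set B := [set g : BM | (minor g == 0) && (minor (row_perm s1 g) != 0)] in IH.
have mB : measurable B by apply: mM; exact: mx_measurable_id.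
have mtB : measurable [set g : BM | B (perm_mx t1 *m (g : 'M[R]_(k + d)))].
  rewrite (_ : [set g | _] = [set g : BM | B (row_perm t1 (g : 'M[R]_(k + d)))]); first exact: mM.
  by apply/seteqP; split => g /=; rewrite row_permE.
apply: (@prob_null_subset _ _ _ mu _ ([set g : BM | (minor g == 0) && (minor (xrow t.1 t.2 g) != 0)] `|`
    [set g : BM | B (perm_mx t1 *m (g : 'M[R]_(k + d)))])).
- by apply: mM; exact: mx_measurable_id.
- apply: measurableU => //; apply: mM; exact: mx_measurable_id.
- move=> g /= /andP[g0]; rewrite row_permM => s1g.
  have [tg|tg] := boolP (minor (xrow t.1 t.2 g) == 0); [right|left].
    by rewrite -row_permE /B /= tg.
  by apply/andP; split.
- have mX : measurable [set g : BM | (minor g == 0) && (minor (xrow t.1 t.2 g) != 0)].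
    by apply: mM; exact: mx_measurable_id.
  have tB0 : mu [set g : BM | B (perm_mx t1 *m (g : 'M[R]_(k + d)))] = 0%E.
    by rewrite haar_preimage//; exact: perm_mx_orthogonal.
  exact: (prob_null_setU mX mtB (minor_exchange_null t.1 t.2) tB0).
Qed.

(** If the minor vanishes then, off a null set, so do all the minors obtained by
    permuting the rows; but an orthogonal matrix has a nonzero one. *)
Lemma minor_null : mu [set g : BM | minor g == 0] = 0%E.
Proof.
pose B (s : {perm 'I_(k + d)}) := [set g : BM | (minor g == 0) && (minor (row_perm s g) != 0)].
have mB s : measurable (B s).
  apply: measurable_minor_exchange; first exact: mx_measurable_id.
  apply: mx_measurable_row_perm; exact: mx_measurable_id.
have m0 : measurable [set g : BM | minor g == 0].
  apply: measurable_set_bool; apply: measurable_fun_eqr => //.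
  by apply: measurable_minor; exact: mx_measurable_id.
have mO := @measurable_orthogonal_group R (k + d).
have OC : mu (~` (orthogonal_group R (k + d) : set BM)) = 0%E.
  by rewrite probability_setC// haar.1 subee.
pose U := \big[setU/set0]_(s <- enum {perm 'I_(k + d)}) B s.
have [mU U0] : measurable U /\ mu U = 0%E.
  rewrite /U; elim/big_ind : _ => [|A A' [mA A0] [mA' A'0]|s _].
  - by split; [exact: measurable0|exact: measure0].
  - by split; [exact: measurableU|exact: prob_null_setU].
  - by split; [exact: mB|exact: minor_perm_null].
apply: (@prob_null_subset _ _ _ mu _ (~` (orthogonal_group R (k + d) : set BM) `|` U)) => //.
- by apply: measurableU => //; exact: measurableC.
- move=> g /= g0; have [gO|gO] := pselect (orthogonal_group R (k + d) g); [right|by left].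
  have [s sg] := orthogonal_minor_neq0 gO.
  rewrite /U -bigcup_seq; exists s; first by rewrite /= mem_enum.
  by rewrite /B /= g0.
- by apply: prob_null_setU => //; exact: measurableC.
Qed.

End minor_null.

(** * The random line cut out by a random subspace *)

Section slice.
Context {R : realType} {k d : nat}.
Hypothesis k0 : (0 < k)%N.
Implicit Types g h : 'M[R]_(k + d).

(** By Cramer's rule [minor g] times the solution [c] of [ulsubmx g *m c = 1]. The
    adjugate keeps it polynomial in the entries of [g], and defined when the minor
    vanishes. *)
Definition slice_coef g : 'cV[R]_k := \adj (ulsubmx g) *m const_mx 1.

(** Let [L] be the space of the vectors whose first [k] coordinates are equal. When
    [minor g] is nonzero the span [X] of the first [k] columns of [g] meets [L] in a
    line, generated by this vector; [X] meets the face of the cube whose first [k]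
    coordinates are [1] exactly when a multiple of this vector lies in that face. *)
Definition slice_vec g : 'cV[R]_(k + d) := lsubmx g *m slice_coef g.

(** The coordinates of [slice_vec g] in an orthonormal basis of [L], which is formed by
    the last [d] basis vectors and by the normalized sum of the first [k]; this
    normalization is the origin of the factor [Num.sqrt k]. *)
Definition slice_dir g (i : 'I_d.+1) : R :=
  if unlift ord0 i is Some j then slice_vec g (rshift k j) 0
  else Num.sqrt k%:R * minor g.

Definition slice_embed (x : 'I_d.+1 -> R) : 'cV[R]_(k + d) :=
  col_mx (const_mx (x ord0 / Num.sqrt k%:R)) (\col_j x (lift ord0 j)).

Let sqrtk0 : Num.sqrt k%:R != 0 :> R.
Proof. by rewrite gt_eqF// sqrtr_gt0 ltr0n. Qed.

(** [slice_embed] is the isometry of [R^(d+1)] onto [L]. *)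
Lemma dot_slice_embed x y : dot (slice_embed x) (slice_embed y) = vdot x y.
Proof.
rewrite /dot big_split_ord /vdot big_ord_recl; congr (_ + _).
  rewrite (eq_bigr (fun=> x ord0 * y ord0 / k%:R)).
    by rewrite sumr_const card_ord -[LHS]mulr_natr divfK// pnatr_eq0 -lt0n.
  move=> i _; rewrite !col_mxEu !mxE mulrACA -invfM -expr2 sqr_sqrtr//.
by apply: eq_bigr => i _; rewrite !col_mxEd !mxE.
Qed.

Lemma usubmx_lsubmx_mul g (c : 'cV[R]_k) : usubmx (lsubmx g *m c) = ulsubmx g *m c.
Proof.
by rewrite -mul_usub_mx; congr (_ *m _); apply/matrixP => i j; rewrite !mxE.
Qed.

Lemma usubmx_slice_vec g : usubmx (slice_vec g) = const_mx (minor g).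
Proof.
rewrite /slice_vec usubmx_lsubmx_mul mulmxA mul_mx_adj mul_scalar_mx.
by apply/matrixP => i j; rewrite !mxE mulr1.
Qed.

Lemma slice_vecE g : slice_vec g = slice_embed (slice_dir g).
Proof.
rewrite -[LHS]vsubmxK usubmx_slice_vec /slice_embed; congr col_mx.
  by rewrite /slice_dir unlift_none mulrC mulKf.
by apply/matrixP => i j; rewrite ord1 !mxE /slice_dir liftK /slice_vec !mxE.
Qed.

(** If [h] maps [slice_vec g] into [L], its image belongs to the line in which the span
    of the first [k] columns of [h *m g] meets [L]. *)
Lemma slice_vec_colinear h g : minor g != 0 -> minor (h *m g) != 0 ->
  (exists w, usubmx (h *m slice_vec g) = const_mx w) ->
  exists2 b, b != 0 & slice_vec (h *m g) = b *: (h *m slice_vec g).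
Proof.
move=> g0 hg0 [w hw].
have hgE : h *m slice_vec g = lsubmx (h *m g) *m slice_coef g.
  by rewrite /slice_vec mulmxA; congr (_ *m _); rewrite mulmx_lsub.
have cE : minor (h *m g) *: slice_coef g = w *: slice_coef (h *m g).
  have e : ulsubmx (h *m g) *m slice_coef g = w *: const_mx 1.
    by rewrite -usubmx_lsubmx_mul -hgE hw; apply/matrixP => i j; rewrite !mxE mulr1.
  by rewrite -mul_scalar_mx -mul_adj_mx -mulmxA e -scalemxAr.
have w0 : w != 0.
  apply: contraNneq g0 => w0; move: cE; rewrite w0 scale0r => /eqP.
  rewrite scaler_eq0 (negbTE hg0) /= => /eqP c0.
  have := usubmx_slice_vec g; rewrite /slice_vec c0 mulmx0 linear0.
  by move=> /matrixP/(_ (Ordinal k0) 0); rewrite !mxE => <-.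
exists (minor (h *m g) / w); first by rewrite mulf_neq0// invr_neq0.
apply: (scalerI w0); rewrite scalerA mulrC divfK// hgE /slice_vec.
by rewrite [LHS]scalemxAr -cE -scalemxAr.
Qed.

Lemma mx_measurable_slice_vec d0 (T : measurableType d0) (f : T -> 'M[R]_(k + d)) :
  mx_measurable f -> mx_measurable (fun t => slice_vec (f t)).
Proof.
move=> mf; apply: mx_measurableM.
  move=> i j; rewrite (_ : (fun _ => _) = fun t => f t i (lshift d j)); first exact: mf.
  by apply/funext => t; rewrite mxE.
apply: mx_measurableM; last exact: mx_measurable_cst.
apply: mx_measurable_adj => i j.
rewrite (_ : (fun _ => _) = fun t => f t (lshift d i) (lshift d j)); first exact: mf.
by apply/funext => t; rewrite !mxE.
Qed.

Lemma measurable_slice_dir d0 (T : measurableType d0) (f : T -> 'M[R]_(k + d)) i :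
  mx_measurable f -> measurable_fun setT (fun t => slice_dir (f t) i).
Proof.
move=> mf; rewrite /slice_dir; case: unliftP => [j|] _.
  exact: mx_measurable_slice_vec.
by apply: measurable_funM => //; exact: measurable_minor.
Qed.

Lemma slice_dir_gt0 g : minor g != 0 -> 0 < vdot (slice_dir g) (slice_dir g).
Proof.
move=> g0; apply: lt_le_trans (sqr_coord_le _ ord0).
by rewrite exprn_even_gt0//= /slice_dir unlift_none mulf_neq0.
Qed.

Lemma cap_slice_dir rho x g : cap rho x (slice_dir g) =
  (rho * (dot (slice_embed x) (slice_embed x) * dot (slice_vec g) (slice_vec g)) <
   dot (slice_embed x) (slice_vec g) ^+ 2).
Proof. by rewrite slice_vecE !dot_slice_embed. Qed.

Section haar.
Variable mu : probability (borel_matrix R (k + d)) R.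
Hypothesis haar : normalized_haar mu.
Local Notation BM := (borel_matrix R (k + d)).

Lemma slice_dir_neq0_prob :
  mu [set g : BM | 0 < vdot (slice_dir g) (slice_dir g)] = 1%E.
Proof.
rewrite -(probability_setT mu); apply: (measure_eq_off_null (N := [set g : BM | minor g == 0])) => //.
- apply: measurable_set_bool; apply: measurable_fun_eqr => //.
  by apply: measurable_minor; exact: mx_measurable_id.
- apply: measurable_set_ltr => //; apply: measurable_vdot => i;
  by apply: measurable_slice_dir; exact: mx_measurable_id.
- exact: minor_null.
- by move=> g /= /negP g0; split => // _; exact: slice_dir_gt0.
Qed.

(** Given two directions of [L] with the same norm, the reflection exchanging them
    preserves [L] and the Haar measure, and it moves the line cut out on [L]
    accordingly, except on the null set where a minor vanishes. *)
Lemma slice_dir_isotropic : isotropic mu (fun g : BM => slice_dir g).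
Proof.
move=> rho x y x0 y0.
have mcap z (f : BM -> 'M[R]_(k + d)) : mx_measurable f ->
    measurable [set g : BM | cap rho z (slice_dir (f g))].
  by move=> mf; apply: measurable_cap => // i; exact: measurable_slice_dir.
pose c := Num.sqrt (vdot x x / vdot y y).
have c0 : c != 0 by rewrite gt_eqF// sqrtr_gt0 divr_gt0.
have cE : vdot x x = vdot (fun i => c * y i) (fun i => c * y i).
  rewrite vdotZl vdotZr mulrA -expr2 sqr_sqrtr ?divfK// ?gt_eqF//.
  by rewrite ltW// divr_gt0.
rewrite (_ : [set g : BM | cap rho y _] = [set g : BM | cap rho (fun i => c * y i) (slice_dir g)]); last first.
  by apply/seteqP; split => g /=; rewrite capZl.
set z := fun i => c * y i in cE *.
pose a := slice_embed x - slice_embed z.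
have [a0|a0] := eqVneq (dot a a) 0.
  have xz : slice_embed x = slice_embed z by apply/eqP; rewrite -subr_eq0; apply/eqP/dot_eq0.
  by congr (mu _); apply/seteqP; split => g /=; rewrite !cap_slice_dir xz.
have hO := reflection_orthogonal a0.
have mh : mx_measurable (fun g : BM => reflection a *m (g : 'M[R]_(k + d))).
  by apply: mx_measurableM; [exact: mx_measurable_cst|exact: mx_measurable_id].
have mz : measurable [set g : BM | cap rho z (slice_dir g)].
  by apply: mcap; exact: mx_measurable_id.
have mN0 (f : BM -> 'M[R]_(k + d)) : mx_measurable f -> measurable [set g : BM | minor (f g) == 0].
  move=> mf; apply: measurable_set_bool; apply: measurable_fun_eqr => //.
  exact: measurable_minor.
have mN1 : measurable [set g : BM | minor g == 0] by apply: mN0; exact: mx_measurable_id.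
have mN2 := mN0 _ mh.
rewrite -(haar_preimage haar hO mz (mcap _ _ mh)).
apply: (measure_eq_off_null (N := [set g : BM | minor g == 0] `|`
    [set g : BM | minor (reflection a *m (g : 'M[R]_(k + d))) == 0])).
- exact: measurableU.
- by apply: mcap; exact: mx_measurable_id.
- exact: mcap.
- apply: prob_null_setU => //; first exact: minor_null.
  rewrite (haar_preimage (A := [set g : BM | minor g == 0]) haar hO)//; exact: minor_null.
move=> g /= /not_orP[/negP g0 /negP hg0].
have inL : exists w, usubmx (reflection a *m slice_vec g) = const_mx w.
  rewrite reflectionE linearB linearZ /= usubmx_slice_vec /a linearB /= !col_mxKu.
  eexists; apply/matrixP => i j; rewrite !mxE; reflexivity.
have [b b0 hE] := slice_vec_colinear g0 hg0 inL.
have hx : reflection a *m slice_embed x = slice_embed z.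
  by apply: reflection_swap => //; rewrite !dot_slice_embed.
rewrite !cap_slice_dir hE -hx !(dotZl, dotZr) !dot_orthogonal//.
move: (dot (slice_embed x) (slice_embed x)) (dot (slice_vec g) (slice_vec g)) => u v.
move: (dot (slice_embed x) (slice_vec g)) => w.
rewrite (_ : rho * (u * (b * (b * v))) = b ^+ 2 * (rho * (u * v))); last by ring.
by rewrite exprMn ltr_pM2l// exprn_even_gt0.
Qed.

End haar.

End slice.

(** * Subspaces meeting a given face of the cube *)

Section subspaces.
Context {R : realType} {n : nat}.
Implicit Types (X : {vspace 'cV[R]_n}) (J E : {set 'I_n}) (x y w : 'cV[R]_n).

(** The projection of [X] onto the coordinates in [J] is bijective. *)
Definition coord_transversal J X : Prop :=
  (forall y, exists2 x, x \in X & forall i, i \in J -> x i 0 = y i 0) /\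
  (forall w, w \in X -> (forall i, i \in J -> w i 0 = 0) -> w = 0).

(** The pair [J], [E] encodes the face of the cube on which the coordinates in [J] are
    fixed, equal to [-1] on [E] and to [1] on the rest of [J]. *)
Definition face_sign E (i : 'I_n) : R := if i \in E then -1 else 1.

(** [cl] selects the closed face or its relative interior; the first enters the upper
    bound and the second the lower bound on the number of vertices. *)
Definition meets_cube_face (cl : bool) J E X : Prop :=
  coord_transversal J X /\
  exists x, [/\ x \in X, forall i, i \in J -> x i 0 = face_sign E i &
    forall i, i \notin J -> `|x i 0| < 1 ?<= if cl].

End subspaces.

Section rotated.
Context {R : realType} {k d : nat}.
Local Notation n := (k + d)%N.
Local Notation rot g := (rotated_std_subspace R (k + d) k g : {vspace 'cV[R]_(k + d)}).

Lemma mem_std_subspace (x : 'cV[R]_(k + d)) :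
  (x \in std_subspace R (k + d) k) = (dsubmx x == 0).
Proof.
apply/idP/eqP => [|x0].
  rewrite /std_subspace => xS.
  have sub : (std_subspace R (k + d) k <= lker (linfun (dsubmx : 'cV[R]_(k + d) -> 'cV[R]_d)))%VS.
    apply/span_subvP => v /mapP[i]; rewrite mem_filter => /andP[ik _] ->.
    rewrite memv_ker lfunE /=; apply/eqP/matrixP => a b; rewrite ord1 !mxE.
    by rewrite -val_eqE /= gtn_eqF// ltn_addr.
  by have := subvP sub x xS; rewrite memv_ker lfunE => /eqP.
rewrite -[x]vsubmxK x0.
have -> : col_mx (usubmx x) 0 = \sum_(i < k) usubmx x i 0 *: (delta_mx (lshift d i) 0 : 'cV[R]_(k + d)).
  apply/matrixP => a b; rewrite ord1 summxE; case: (split_ordP a) => a' ->.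
    rewrite col_mxEu (bigD1 a')//= !mxE !eqxx mulr1 big1 ?addr0// => i ia.
    by rewrite !mxE eq_lshift eq_sym (negbTE ia) mulr0.
  by rewrite col_mxEd mxE big1// => i _; rewrite !mxE eq_rlshift mulr0.
apply: memv_suml => i _; apply: memvZ; apply: memv_span.
by apply/mapP; exists (lshift d i) => //; rewrite mem_filter mem_enum /= ltn_ord.
Qed.

Lemma mem_rotated (g : 'M[R]_(k + d)) (x : 'cV[R]_(k + d)) :
  x \in rot g <-> exists c : 'cV[R]_k, x = lsubmx g *m c.
Proof.
have E (v : 'cV[R]_(k + d)) : dsubmx v = 0 -> g *m v = lsubmx g *m usubmx v.
  by move=> v0; rewrite -{1}[v]vsubmxK v0 -{1}[g]hsubmxK mul_row_col mulmx0 addr0.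
split=> [/memv_imgP[v]|[c ->]].
  by rewrite mem_std_subspace => /eqP /E gv ->; exists (usubmx v); rewrite lfunE.
apply/memv_imgP; exists (col_mx c 0); first by rewrite mem_std_subspace col_mxKd.
by rewrite lfunE /= E ?col_mxKd// col_mxKu.
Qed.

Definition first_coords : {set 'I_(k + d)} := finset (fun i : 'I_(k + d) => (i < k)%N).

Lemma lshift_first (i : 'I_k) : lshift d i \in first_coords.
Proof. by rewrite finset.in_set /= ltn_ord. Qed.

Lemma rshift_first (i : 'I_d) : rshift k i \notin first_coords.
Proof. by rewrite finset.in_set /= -leqNgt leq_addr. Qed.

Lemma lsubmx_mul_up (g : 'M[R]_(k + d)) (c : 'cV[R]_k) (i : 'I_k) :
  (lsubmx g *m c) (lshift d i) 0 = (ulsubmx g *m c) i 0.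
Proof. by rewrite -usubmx_lsubmx_mul [RHS]mxE. Qed.

Lemma transversal_first (g : 'M[R]_(k + d)) :
  coord_transversal first_coords (rot g) <-> minor g != 0.
Proof.
split=> [[surj _]|g0].
  have inv (j : 'I_k) : exists c : 'cV[R]_k, ulsubmx g *m c = delta_mx j 0.
    have [x /mem_rotated[c xE] xj] := surj (col_mx (delta_mx j 0) 0).
    exists c; apply/matrixP => i l; rewrite ord1 -lsubmx_mul_up -xE xj ?lshift_first//.
    by rewrite col_mxEu.
  have [B BE] := choice inv.
  have : ulsubmx g *m (\matrix_(i, j) B j i 0) = 1%:M.
    apply/matrixP => i j; have /matrixP/(_ i 0) := BE j; rewrite !mxE eqxx andbT => <-.
    by apply: eq_bigr => l _; rewrite !mxE.
  by move=> /mulmx1_unit[]; rewrite unitmxE unitfE.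
have gU : ulsubmx g \in unitmx by rewrite unitmxE unitfE.
split=> [y|w /mem_rotated[c ->] c0].
  exists (lsubmx g *m (invmx (ulsubmx g) *m usubmx y)).
    by apply/mem_rotated; eexists.
  move=> i; case: (split_ordP i) => i' ->; last by rewrite (negbTE (rshift_first _)).
  by rewrite lsubmx_mul_up mulmxA mulmxV// mul1mx mxE.
suff -> : c = 0 by rewrite mulmx0.
rewrite -[c]mul1mx -(mulVmx gU) -mulmxA (_ : ulsubmx g *m c = 0) ?mulmx0//.
by apply/matrixP => i j; rewrite ord1 -lsubmx_mul_up c0 ?lshift_first// mxE.
Qed.

(** The condition that the span of the first [k] columns of [g] meets the face whose
    first [k] coordinates are [1], as inequalities between polynomials in the entries of
    [g]. *)
Definition slice_hits (cl : bool) (g : 'M[R]_(k + d)) : bool :=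
  (minor g != 0) &&
  [forall j : 'I_d, `|slice_vec g (rshift k j) 0| < `|minor g| ?<= if cl].

Lemma slice_vec_rotated (g : 'M[R]_(k + d)) : slice_vec g \in rot g.
Proof. by apply/mem_rotated; eexists. Qed.

Lemma slice_vec_first (g : 'M[R]_(k + d)) (i : 'I_k) : slice_vec g (lshift d i) 0 = minor g.
Proof. by have /matrixP/(_ i 0) := usubmx_slice_vec g; rewrite !mxE. Qed.

Lemma meets_first (cl : bool) (g : 'M[R]_(k + d)) :
  meets_cube_face cl first_coords finset.set0 (rot g) <-> slice_hits cl g.
Proof.
split=> [[tr [x [xX x1 xl]]]|/andP[g0 /forallP gl]].
  have g0 := (transversal_first g).1 tr; rewrite /slice_hits g0 /=.
  have xE : slice_vec g = minor g *: x.
    apply/eqP; rewrite -subr_eq0; apply/eqP; apply: tr.2.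
      by rewrite memvB// ?memvZ// slice_vec_rotated.
    move=> i iJ; rewrite [LHS]mxE [X in _ + X]mxE [X in _ - X]mxE x1//.
    rewrite /face_sign finset.in_set0 mulr1.
    case: (split_ordP i) iJ => i' -> iJ; last by rewrite (negbTE (rshift_first _)) in iJ.
    by rewrite slice_vec_first subrr.
  apply/forallP => j; rewrite xE mxE normrM -[X in _ < X ?<= if _]mulr1.
  by rewrite lteif_pM2l ?normr_gt0// xl// rshift_first.
split; first exact/transversal_first.
exists ((minor g)^-1 *: slice_vec g); split.
- by rewrite memvZ// slice_vec_rotated.
- move=> i; case: (split_ordP i) => i' -> iJ; last by rewrite (negbTE (rshift_first _)) in iJ.
  by rewrite mxE slice_vec_first mulVf// /face_sign finset.in_set0.
- move=> i; case: (split_ordP i) => i' -> iJ; first by rewrite lshift_first in iJ.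
  rewrite mxE normrM normfV mulrC.
  by rewrite lteif_pdivrMr ?normr_gt0// mul1r.
Qed.

(** The symmetries of the cube, which act transitively on its faces of a given
    dimension. *)
Definition signed_perm (E : {set 'I_(k + d)}) (s : {perm 'I_(k + d)}) : 'M[R]_(k + d) :=
  diag_mx (\row_i face_sign E i) *m perm_mx s^-1.

Lemma face_sign_sqr E (i : 'I_(k + d)) : face_sign E i * face_sign E i = 1 :> R.
Proof. by rewrite /face_sign; case: ifP; rewrite ?mulr1// mulrNN mulr1. Qed.

Lemma face_sign_norm E (i : 'I_(k + d)) : `|face_sign E i| = 1 :> R.
Proof. by rewrite /face_sign; case: ifP; rewrite ?normrN normr1. Qed.

Lemma signed_perm_orthogonal E s : orthogonal_group R (k + d) (signed_perm E s).
Proof.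
rewrite /orthogonal_group /= /signed_perm trmx_mul tr_diag_mx mulmxA.
rewrite -[_ *m diag_mx _ *m diag_mx _]mulmxA mulmx_diag.
rewrite (_ : \row_j _ = const_mx 1) ?diag_const_mx ?mulmx1; last first.
  by apply/matrixP => i j; rewrite !mxE face_sign_sqr.
by rewrite tr_perm_mx -perm_mxM mulVg perm_mx1.
Qed.

Lemma signed_permE E s (x : 'cV[R]_(k + d)) i :
  (signed_perm E s *m x) i 0 = face_sign E i * x (s^-1%g i) 0.
Proof.
by rewrite /signed_perm -mulmxA mul_diag_mx -row_permE !mxE.
Qed.

Lemma mem_rotated_mul (h g : 'M[R]_(k + d)) (y : 'cV[R]_(k + d)) :
  y \in rot (h *m g) <-> exists2 x, x \in rot g & y = h *m x.
Proof.
split=> [/mem_rotated[c ->]|[x /mem_rotated[c ->] ->]].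
  exists (lsubmx g *m c); first by apply/mem_rotated; exists c.
  by rewrite mulmxA mulmx_lsub.
by apply/mem_rotated; exists c; rewrite mulmxA mulmx_lsub.
Qed.

Lemma transversal_signed_perm (E J : {set 'I_(k + d)}) (s : {perm 'I_(k + d)}) (g : 'M[R]_(k + d)) :
  coord_transversal (s @: J)%SET (rot (signed_perm E s *m g)) <-> coord_transversal J (rot g).
Proof.
have sJ i : (i \in (s @: J)%SET) = (s^-1%g i \in J).
  by rewrite -[i in LHS](permKV s) mem_imset//; exact: perm_inj.
have E0 i : face_sign E i != 0 :> R by rewrite -normr_gt0 face_sign_norm.
split=> -[surj inj]; split.
- move=> y; have [_ /mem_rotated_mul[x xX ->] xy] := surj (signed_perm E s *m y).
  exists x => // i iJ; have := xy (s i); rewrite sJ permK => /(_ iJ).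
  by rewrite !signed_permE permK => /(mulfI (E0 _)).
- move=> w wX w0; have : signed_perm E s *m w = 0.
    apply: inj; first by apply/mem_rotated_mul; exists w.
    by move=> i; rewrite sJ => /w0 wi; rewrite signed_permE wi mulr0.
  move=> sw; apply/matrixP => i j; rewrite ord1 [RHS]mxE.
  have /matrixP/(_ (s i) 0) := sw; rewrite signed_permE permK [RHS]mxE => /eqP.
  by rewrite mulf_eq0 (negbTE (E0 _)) /= => /eqP.
- move=> y; have [x xX xy] := surj (\col_i (face_sign E (s i) * y (s i) 0)).
  exists (signed_perm E s *m x); first by apply/mem_rotated_mul; exists x.
  move=> i; rewrite sJ => /xy; rewrite signed_permE mxE permKV => ->.
  by rewrite mulrA face_sign_sqr mul1r.
- move=> _ /mem_rotated_mul[x xX ->] x0; rewrite (inj x) ?mulmx0// => i iJ.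
  have := x0 (s i); rewrite sJ permK => /(_ iJ) /eqP.
  by rewrite signed_permE permK mulf_eq0 (negbTE (E0 _)) /= => /eqP.
Qed.

Lemma meets_signed_perm cl (E J : {set 'I_(k + d)}) (s : {perm 'I_(k + d)}) (g : 'M[R]_(k + d)) :
  meets_cube_face cl (s @: J)%SET E (rot (signed_perm E s *m g)) <->
  meets_cube_face cl J finset.set0 (rot g).
Proof.
have sJ i : (i \in (s @: J)%SET) = (s^-1%g i \in J).
  by rewrite -[i in LHS](permKV s) mem_imset//; exact: perm_inj.
have E0 i : face_sign E i != 0 :> R by rewrite -normr_gt0 face_sign_norm.
split=> -[tr [x [xX x1 xl]]].
  split; first exact: (transversal_signed_perm E J s g).1 tr.
  move: xX x1 xl => /mem_rotated_mul[z zX ->] z1 zl; exists z; split => // i iJ.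
    have := z1 (s i); rewrite sJ permK => /(_ iJ).
    rewrite signed_permE permK -[RHS]mulr1 => /(mulfI (E0 _)) ->.
    by rewrite /face_sign finset.in_set0.
  have := zl (s i); rewrite sJ permK => /(_ iJ).
  by rewrite signed_permE permK normrM face_sign_norm mul1r.
split; first exact: (transversal_signed_perm E J s g).2 tr.
exists (signed_perm E s *m x); split; first by apply/mem_rotated_mul; exists x.
  by move=> i; rewrite sJ signed_permE => /x1 ->; rewrite /face_sign finset.in_set0 mulr1.
by move=> i; rewrite sJ signed_permE normrM face_sign_norm mul1r => /xl.
Qed.

End rotated.

(** * Vertices of a section of the cube *)

Section faces.
Context {R : realType} {n : nat} (X : {vspace 'cV[R]_n}).
Implicit Types (J E : {set 'I_n}) (x y w : 'cV[R]_n).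

Definition face_slice J E : set 'cV[R]_n :=
  [set x | x \in X /\ forall i, i \in J -> x i 0 = face_sign E i].

Lemma face_slice_unique J E x y : coord_transversal J X ->
  face_slice J E x -> face_slice J E y -> x = y.
Proof.
move=> [_ inj] [xX x1] [yX y1]; apply/eqP; rewrite -subr_eq0; apply/eqP; apply: inj.
  by rewrite memvB.
by move=> i iJ; rewrite !mxE x1// y1// subrr.
Qed.

Lemma has_affine_dim_set1 x : has_affine_dim 0 [set x].
Proof.
split; first by exists x.
exists 0%VS; split; first exact: dimv0.
- by move=> y z -> ->; rewrite subrr mem0v.
- by move=> W _; exact: sub0v.
Qed.

Lemma face_signM E i (x : 'cV[R]_n) : `|x i 0| <= 1 -> face_sign E i * x i 0 <= 1.
Proof. by rewrite /face_sign; case: ifP => _; rewrite ?mulN1r ?mul1r ler_norml => /andP[]; lra. Qed.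

Lemma face_signM_eq1 E i (x : 'cV[R]_n) : face_sign E i * x i 0 = 1 -> x i 0 = face_sign E i.
Proof. by rewrite /face_sign; case: ifP => _; rewrite ?mulN1r ?mul1r => // <-; rewrite opprK. Qed.

(** The linear form with coefficients [face_sign E] on [J] is maximal on the cube
    exactly along the face of [J], [E], so it supports the section at its only point in
    that face. *)
Lemma face_slice_face cl J E : meets_cube_face cl J E X ->
  faces 0 (cube_section X) (face_slice J E).
Proof.
move=> [tr [x [xX x1 xl]]].
have xF : face_slice J E x by [].
have FE : face_slice J E = [set x].
  by apply/seteqP; split=> y => [yF|->//]; exact: face_slice_unique tr yF xF.
split; last by rewrite FE; exact: has_affine_dim_set1.
pose a : 'cV[R]_n := \col_i (if i \in J then face_sign E i else 0).
have aE y : dot a y = \sum_(i in J) face_sign E i * y i 0.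
  rewrite /dot [RHS]big_mkcond; apply: eq_bigr => i _; rewrite mxE.
  by case: ifP => _; rewrite ?mul0r.
have card : (\sum_(i in J) 1 : R) = #|J|%:R by rewrite sumr_const.
exists a, #|J|%:R; split.
  move=> y [_ yC]; rewrite aE -card; apply: ler_sum => i _; exact: face_signM (yC i).
rewrite FE; apply/seteqP; split=> y.
  move=> ->; split; first split=> //.
    move=> i; have [iJ|iJ] := boolP (i \in J); last first.
      by have := xl i iJ; case: cl {xl} => //= /ltW.
    by rewrite x1// /face_sign; case: ifP; rewrite ?normrN normr1.
  rewrite aE -card; apply: eq_bigr => i iJ; rewrite x1// /face_sign.
  by case: ifP; rewrite ?mulrNN mulr1.
move=> [[yX yC] yJ]; apply: (face_slice_unique tr _ xF); split=> // i iJ.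
apply: face_signM_eq1.
have S0 : \sum_(i in J) (1 - face_sign E i * y i 0) = 0.
  by rewrite sumrB card -aE yJ subrr.
have ge0 j : j \in J -> 0 <= 1 - face_sign E j * y j 0.
  by move=> _; rewrite subr_ge0; exact: face_signM (yC j).
have := psumr_eq0P ge0 S0 iJ; move=> /eqP; rewrite subr_eq0 => /eqP h.
exact: esym h.
Qed.

(** A point of the relative interior of a face determines that face through its
    coordinates of absolute value [1]. *)
Lemma face_slice_inj J E J' E' : (E \subset J)%SET -> (E' \subset J')%SET ->
  meets_cube_face false J E X -> meets_cube_face false J' E' X ->
  face_slice J E = face_slice J' E' -> (J, E) = (J', E').
Proof.
move=> EJ EJ' [tr [x [xX x1 xl]]] [tr' [y [yX y1 yl]]] FF.
have xy : x = y.
  have yF : face_slice J E y by rewrite FF.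
  exact: face_slice_unique tr _ yF.
subst y.
have Jx (K F : {set 'I_n}) : (forall i, i \in K -> x i 0 = face_sign F i) ->
    (forall i, i \notin K -> `|x i 0| < 1 ?<= if false) ->
    forall i, (i \in K) = (`|x i 0| == 1).
  move=> h h' i; have [iK|iK] := boolP (i \in K).
    by rewrite h// /face_sign; case: ifP; rewrite ?normrN normr1 eqxx.
  by apply/esym/negbTE; rewrite lt_eqF//; exact: h'.
have JJ : J = J' by apply/finset.setP => i; rewrite (Jx J E)// (Jx J' E').
congr pair => //.
have Ex (K F : {set 'I_n}) : (F \subset K)%SET -> (forall i, i \in K -> x i 0 = face_sign F i) ->
    forall i, (i \in F) = (i \in K) && (x i 0 == -1).
  move=> FK h i; have [iK|iK] := boolP (i \in K) => /=; last first.
    by apply: contraNF iK => /(fintype.subsetP FK).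
  rewrite h// /face_sign; case: ifP; rewrite ?eqxx// => _.
  by apply/esym/negbTE; rewrite -subr_eq0 opprK -[1 + 1]/(2%:R) pnatr_eq0.
by apply/finset.setP => i; rewrite (Ex J E)// (Ex J' E')// JJ.
Qed.

(** At a vertex [x] no nonzero [w] of [X] vanishes on all the coordinates where [x] is
    on the boundary of the cube: otherwise [x + del w] and [x - del w] would both lie in
    the section for a small [del], and a supporting form would take the same value at
    the three points. *)
Lemma vertex_tight F : faces 0 (cube_section X) F ->
  exists x, [/\ F = [set x], cube_section X x &
    forall w, w \in X -> (forall i, `|x i 0| = 1 -> w i 0 = 0) -> w = 0].
Proof.
move=> [[a [b [ab FE]]] [[x Fx] [V [V0 VF _]]]].
have Vz y : F y -> y = x.
  move=> Fy; apply/eqP; rewrite -subr_eq0 -memv0.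
  by have /eqP := V0; rewrite dimv_eq0 => /eqP <-; exact: VF.
exists x; move: (Fx); rewrite FE /= => -[[xX xC] xb]; split => //.
  by rewrite -FE; apply/seteqP; split=> y => [/Vz ->//|->//].
move=> w wX w0.
(* Small enough to keep each coordinate with [`|x i 0| < 1] inside the cube; the tight
   coordinates do not move. *)
pose del := \big[Num.min/1]_(i < n | `|x i 0| != 1) ((1 - `|x i 0|) / (1 + `|w i 0|)).
have w1 i : 0 < 1 + `|w i 0| by rewrite ltr_pwDl.
have del0 : 0 < del.
  rewrite /del; elim/big_ind : _ => // [u v u0 v0|i xi].
    by rewrite lt_min u0.
  by rewrite divr_gt0// subr_gt0 lt_neqAle xi /=; exact: xC.
have delw i (e : R) : `|e| = del -> `|(x + e *: w) i 0| <= 1.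
  move=> ee; rewrite !mxE; have [xi|xi] := eqVneq (`|x i 0|) 1.
    by rewrite w0// mulr0 addr0 xi.
  apply: le_trans (ler_normD _ _) _; rewrite normrM ee.
  have : del <= (1 - `|x i 0|) / (1 + `|w i 0|).
    rewrite /del; exact: bigmin_le_cond.
  rewrite ler_pdivlMr// mulrDr mulr1 => h; lra.
have inX e : x + e *: w \in X by rewrite memvD// memvZ.
have dp : dot a (x + del *: w) <= b.
  by apply: ab; split; [exact: inX|move=> i; apply: delw; rewrite gtr0_norm].
have dm : dot a (x + (- del) *: w) <= b.
  by apply: ab; split; [exact: inX|move=> i; apply: delw; rewrite normrN gtr0_norm].
have aw : dot a w = 0.
  move: dp dm; rewrite !dotDr !dotZr xb => dp dm.
  have : del * dot a w = 0 by apply/eqP; rewrite eq_le; apply/andP; split; lra.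
  by move=> /eqP; rewrite mulf_eq0 gt_eqF//= => /eqP.
have : F (x + del *: w).
  rewrite FE; split; last by rewrite dotDr dotZr aw mulr0 addr0.
  by split; [exact: inX|move=> i; apply: delw; rewrite gtr0_norm].
move=> /Vz /eqP; rewrite -subr_eq0 addrC addKr scaler_eq0 gt_eqF//= => /eqP.
by [].
Qed.

(** If [X] projects bijectively onto every set of [k] coordinates, a vertex has at least
    [k] tight coordinates, since [X] contains nonzero vectors vanishing on any smaller
    set; [k] of them single it out. *)
Lemma vertex_face_slice k F : (k <= n)%N ->
  (forall J, #|J| = k -> coord_transversal J X) ->
  faces 0 (cube_section X) F ->
  exists J E, [/\ #|J| = k, (E \subset J)%SET, meets_cube_face true J E X & F = face_slice J E].
Proof.
move=> kn gen /vertex_tight[x [FE [xX xC] tight]].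
pose T := finset (fun i : 'I_n => `|x i 0| == 1).
have kT : (k <= #|T|)%N.
  rewrite leqNgt; apply/negP => Tk.
  have : (k - #|T| <= #|~: T|)%N by rewrite leq_subLR finset.cardsC card_ord.
  move=> /card_geqP[s [us ss sT]].
  case: s us ss sT => [_ /esym/eqP|j s us ss sT].
    by rewrite subn_eq0 leqNgt Tk.
  have jT : j \notin T by rewrite -finset.in_setC sT ?mem_head.
  pose J := finset.setU T (finset (fun i => i \in j :: s)).
  have Jk : #|J| = k.
    rewrite finset.cardsU (_ : #|finset _| = (k - #|T|)%N); last first.
      by rewrite -ss -(card_uniqP us); apply: eq_card => i; rewrite finset.in_set.
    rewrite subnKC ?(ltnW Tk)//.
    rewrite (_ : finset.setI _ _ = finset.set0) ?finset.cards0 ?subn0//.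
    apply/finset.setP => i; rewrite finset.in_setI finset.in_set finset.in_set0.
    apply/negbTE; rewrite negb_and orbC -implybE; apply/implyP => /sT.
    by rewrite finset.in_setC.
  have [w wX wJ] := (gen _ Jk).1 (delta_mx j 0).
  have w0 : w = 0.
    apply: tight => // i xi.
    have iT : i \in T by rewrite finset.in_set xi.
    rewrite wJ ?finset.in_setU ?iT// mxE andbT; case: eqP => // ij.
    by rewrite -ij iT in jT.
  have := wJ j; rewrite w0 !mxE !eqxx /= finset.in_setU finset.in_set mem_head orbT => /(_ isT)/eqP.
  by rewrite eq_sym oner_eq0.
have [J [JT Jk]] : exists J : {set 'I_n}, (J \subset T)%SET /\ #|J| = k.
  have /card_geqP[s [us ss sT]] := kT.
  exists (finset (fun i => i \in s)); split; last first.
    by rewrite -ss -(card_uniqP us); apply: eq_card => i; rewrite finset.in_set.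
  by apply/fintype.subsetP => i; rewrite finset.in_set => /sT.
exists J, (finset (fun i => (i \in J) && (x i 0 == -1))).
have JE i : i \in J -> x i 0 = face_sign (finset (fun i => (i \in J) && (x i 0 == -1))) i.
  move=> iJ; rewrite /face_sign finset.in_set iJ /=.
  have := fintype.subsetP JT i iJ; rewrite finset.in_set.
  by have [//|x1] := eqVneq (x i 0) (-1); rewrite eqr_norml (negbTE x1) orbF ler01 andbT => /eqP.
split=> //.
- by apply/fintype.subsetP => i; rewrite finset.in_set => /andP[].
- split; first exact: gen.
  by exists x; split => // i _; exact: xC.
- rewrite FE; apply/seteqP; split=> y => [->//|yF].
  by apply: face_slice_unique (gen _ Jk) yF _.
Qed.

(** The faces of the cube of codimension [k]. *)
Definition patterns (k : nat) : {set {set 'I_n} * {set 'I_n}} :=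
  finset (fun p : {set 'I_n} * {set 'I_n} => (#|p.1| == k) && (p.2 \subset p.1)).

Lemma card_patterns k : #|patterns k| = ('C(n, k) * 2 ^ k)%N.
Proof.
rewrite -sum1_card (eq_bigl (fun p : {set 'I_n} * {set 'I_n} => (#|p.1| == k) && (p.2 \subset p.1))); last first.
  by move=> p; rewrite finset.in_set.
rewrite -(pair_big_dep (fun J : {set 'I_n} => #|J| == k) (fun J E : {set 'I_n} => E \subset J) (fun _ _ => 1%N))/=.
rewrite (eq_bigr (fun=> 2 ^ k)%N) => [|J /eqP Jk]; last first.
  rewrite sum1dep_card -Jk -finset.card_powerset; apply: eq_card => E.
  by rewrite finset.powersetE.
rewrite sum_nat_const; congr (_ * _)%N; have := card_draws 'I_n k; rewrite card_ord => <-.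
by apply: eq_card => J; rewrite finset.in_set.
Qed.

Local Notation S := (faces 0 (cube_section X)).

Let count_meets cl k : (\sum_(p in patterns k) `[< meets_cube_face cl p.1 p.2 X >])%N =
  size (enum [pred p | (p \in patterns k) && `[< meets_cube_face cl p.1 p.2 X >] ]).
Proof.
rewrite -cardE -sum1_card [RHS]big_mkcondr; apply: eq_bigr => p _.
by case: (`[< _ >]).
Qed.

(** Distinct faces that [X] meets transversally in their relative interior give distinct
    vertices; this bound holds at every [X]. *)
Lemma count_vertices_ge k :
  ((\sum_(p in patterns k) `[< meets_cube_face false p.1 p.2 X >])%N%:R%:E
    <= counting S :> \bar R)%E.
Proof.
rewrite /counting; case: asboolP => [fS|_]; last exact: leey.
rewrite lee_fin ler_nat count_meets.
pose phi (p : {set 'I_n} * {set 'I_n}) := face_slice p.1 p.2.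
set s := enum _.
have sP p : p \in s -> (p.2 \subset p.1)%SET /\ meets_cube_face false p.1 p.2 X.
  by rewrite mem_enum => /andP[]; rewrite finset.in_set => /andP[_ ?] /asboolP.
rewrite -(size_map phi); apply: uniq_leq_size.
  rewrite map_inj_in_uniq ?enum_uniq// => -[J E] [J' E'] /sP[/= EJ m] /sP[/= EJ' m'].
  exact: face_slice_inj.
move=> F /mapP[p /sP[_ m] ->]; rewrite in_fset_set// inE.
exact: face_slice_face m.
Qed.

Lemma count_vertices_le k : (k <= n)%N ->
  (forall J, #|J| = k -> coord_transversal J X) ->
  (counting S <= (\sum_(p in patterns k) `[< meets_cube_face true p.1 p.2 X >])%N%:R%:E :> \bar R)%E.
Proof.
move=> kn gen; rewrite count_meets.
pose phi (p : {set 'I_n} * {set 'I_n}) := face_slice p.1 p.2.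
set s := enum _.
have sub F : S F -> F \in map phi s.
  move=> /(vertex_face_slice kn gen)[J [E [Jk EJ m ->]]]; apply/mapP; exists (J, E) => //.
  by rewrite mem_enum inE /= finset.in_set /= Jk eqxx EJ; apply/asboolP.
have fS : finite_set S.
  by apply: (@sub_finite_set _ _ [set` map phi s]) => //; exact: finite_seq.
rewrite /counting asboolT// lee_fin ler_nat -(size_map phi); apply: uniq_leq_size.
  exact: finmap.fset_uniq.
by move=> F; rewrite in_fset_set// inE => /sub.
Qed.

End faces.

(** * The expected number of vertices *)

(** The integral of a nonnegative function is a supremum over the simple functions below
    it, and is thus monotone without any measurability. The number of vertices is handled
    through measurable bounds on either side only. *)
Lemma integral_le_pointwise d (T : measurableType d) (R : realType)
    (m : {measure set T -> \bar R}) (f g : T -> \bar R) :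
  (forall x, 0 <= f x)%E -> (forall x, f x <= g x)%E ->
  (\int[m]_x f x <= \int[m]_x g x)%E.
Proof.
move=> f0 fg; have g0 x : (0 <= g x)%E by apply: le_trans (fg x).
rewrite !ge0_integralTE//; apply: le_ereal_sup => _ [h hf <-].
by exists h => // x; apply: le_trans (fg x); exact: hf.
Qed.

Section slice_hits_prob.
Context {R : realType} {k d : nat}.
Hypothesis k0 : (0 < k)%N.

Let sqrtk0 : 0 < Num.sqrt k%:R :> R.
Proof. by rewrite sqrtr_gt0 ltr0n. Qed.

Lemma measurable_slice_hits cl d0 (T : measurableType d0) (f : T -> 'M[R]_(k + d)) :
  mx_measurable f -> measurable [set t | slice_hits cl (f t)].
Proof.
move=> mf.
have mm := measurable_minor mf.
have ms (j : 'I_d) : measurable_fun setT (fun t => `|slice_vec (f t) (rshift k j) 0|).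
  by apply: measurableT_comp => //; exact: mx_measurable_slice_vec.
have mn : measurable_fun setT (fun t => `|minor (f t)|) by exact: measurableT_comp.
rewrite (_ : [set t | _] = [set t | minor (f t) != 0] `&`
    [set t | [forall j : 'I_d, `|slice_vec (f t) (rshift k j) 0| < `|minor (f t)| ?<= if cl] ]).
  apply: measurableI.
    by apply: measurable_set_bool; apply: measurable_neg; exact: measurable_fun_eqr.
  apply: measurable_set_forall => j; apply: measurable_set_bool.
  by case: cl => /=; [exact: measurable_fun_ler|exact: measurable_fun_ltr].
by apply/seteqP; split=> t /=; [move=> /andP[]|move=> [? ?]; apply/andP].
Qed.

Lemma slice_dir_cone (t : R) (g : 'M[R]_(k + d)) :
  cone t (slice_dir g) =
  [forall j : 'I_d, `|slice_vec g (rshift k j) 0| < t * (Num.sqrt k%:R * `|minor g|)].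
Proof.
apply: eq_forallb => j; rewrite /slice_dir liftK unlift_none normrM.
by rewrite (gtr0_norm sqrtk0).
Qed.

End slice_hits_prob.

Section slice_hits_bounds.
Context {R : realType} {k : nat}.
Hypothesis k0 : (0 < k)%N.
Let t : R := 1 / Num.sqrt k%:R.

Let sqrtk0 : 0 < Num.sqrt k%:R :> R.
Proof. by rewrite sqrtr_gt0 ltr0n. Qed.

Let t0 : 0 < t. Proof. by rewrite divr_gt0. Qed.

(** With [t = 1 / sqrt k] the cone condition on [slice_dir g] is exactly the condition
    that the slice lies in the open face. *)
Lemma slice_hits_ge m (mu : probability (borel_matrix R (k + m.+1)) R) :
  normalized_haar mu ->
  (((2 / pi * atan t) ^+ m.+1)%:E <=
   mu [set g : borel_matrix R (k + m.+1) | slice_hits false (g : 'M[R]_(k + m.+1))])%E.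
Proof.
move=> haar.
have mid := @mx_measurable_id R (k + m.+1).
apply: le_trans (isotropic_cone_ge (t := t) _ (slice_dir_isotropic k0 haar) (slice_dir_neq0_prob k0 haar) t0) _.
  by move=> i; exact: measurable_slice_dir.
apply: le_measure; rewrite ?inE.
- by apply: measurable_cone => i; exact: measurable_slice_dir.
- exact: measurable_slice_hits.
move=> g /=; rewrite slice_dir_cone// /t mulrA divfK ?gt_eqF// mul1r => h.
rewrite /slice_hits h andbT; apply: contraTneq h => ->.
by rewrite negb_forall; apply/existsP; exists ord0; rewrite normr0 -leNgt.
Qed.

(** The closed face is contained in the cone of every aperture [s > t]. *)
Lemma slice_hits_le (mu : probability (borel_matrix R (k + 1)) R) :
  normalized_haar mu ->
  (mu [set g : borel_matrix R (k + 1) | slice_hits true (g : 'M[R]_(k + 1))] <=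
   (2 / pi * atan t)%:E)%E.
Proof.
move=> haar.
have mid := @mx_measurable_id R (k + 1).
have mS := measurable_slice_hits true mid.
rewrite -(fineK (fin_num_measure mu _ mS)) lee_fin.
apply: (@ge_right_limit _ (fun s => 2 / pi * atan s)).
  by apply: cvgM; [exact: cvg_cst|exact: continuous_atan].
move=> s ts; rewrite -lee_fin fineK; last exact: fin_num_measure.
pose u := (t + s) / 2.
have tu : t < u by rewrite /u; lra.
have us : u < s by rewrite /u; lra.
apply: le_trans (isotropic_cone1_le (s := u) _ (slice_dir_isotropic k0 haar)
  (slice_dir_neq0_prob k0 haar) (ltW (lt_trans t0 tu)) us); last first.
  by move=> i; exact: measurable_slice_dir.
apply: le_measure; rewrite ?inE//.
  by apply: measurable_cone => i; exact: measurable_slice_dir.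
move=> g /= /andP[g0 /forallP h]; rewrite slice_dir_cone//; apply/forallP => j.
apply: le_lt_trans (h j) _; rewrite mulrA -[ltLHS]mul1r ltr_pM2r ?normr_gt0//.
by rewrite -ltr_pdivrMr.
Qed.

End slice_hits_bounds.

Section expected.
Context {R : realType} {k d : nat} (mu : probability (borel_matrix R (k + d)) R).
Hypothesis haar : normalized_haar mu.
Local Notation BM := (borel_matrix R (k + d)).
Local Notation rot g := (rotated_std_subspace R (k + d) k g : {vspace 'cV[R]_(k + d)}).

Lemma first_coords_perm (J : {set 'I_(k + d)}) : #|J| = k ->
  exists s : {perm 'I_(k + d)}, J = (s @: first_coords)%SET.
Proof.
move=> Jk; pose f (i : 'I_k) := enum_val (cast_ord (esym Jk) i).
have fI : injective f by move=> i j /enum_val_inj/cast_ord_inj.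
have [s sE] := perm_extending_inj fI; exists s.
apply/esym/eqP; rewrite eqEcard; apply/andP; split.
  apply/fintype.subsetP => _ /imsetP[x xf ->].
  case: (split_ordP x) xf => i -> xf; last by rewrite (negbTE (rshift_first _)) in xf.
  by rewrite sE enum_valP.
rewrite card_imset ?Jk; last exact: perm_inj.
have ck : #|codom (@lshift k d)| = k by rewrite card_codom ?card_ord//; exact: lshift_inj.
rewrite -[leqLHS]ck.
by apply: subset_leq_card; apply/fintype.subsetP => _ /codomP[i ->]; exact: lshift_first.
Qed.

Let mid : mx_measurable (fun g : BM => (g : 'M[R]_(k + d))).
Proof. exact: mx_measurable_id. Qed.

Lemma trmx_orthogonal (h : 'M[R]_(k + d)) :
  orthogonal_group R (k + d) h -> orthogonal_group R (k + d) h^T.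
Proof. by move=> hO; rewrite /orthogonal_group /= trmxK; exact: mulmx1C. Qed.

(** A signed permutation carries the face [J], [E] to the face whose first [k]
    coordinates are [1]. *)
Lemma meets_rotated cl (E J : {set 'I_(k + d)}) : #|J| = k ->
  exists2 h, orthogonal_group R (k + d) h &
    forall g, meets_cube_face cl J E (rot g) <-> slice_hits cl (h *m g).
Proof.
move=> /first_coords_perm[s ->].
have MO := @signed_perm_orthogonal R k d E s.
exists (signed_perm E s)^T; first exact: trmx_orthogonal.
move=> g; rewrite -meets_first -(meets_signed_perm cl E _ s).
by rewrite mulmxA (mulmx1C MO) mul1mx.
Qed.

Lemma measurable_meets cl (p : {set 'I_(k + d)} * {set 'I_(k + d)}) : #|p.1| = k ->
  measurable [set g : BM | meets_cube_face cl p.1 p.2 (rot g)].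
Proof.
move=> /(meets_rotated cl p.2)[h _ hE].
rewrite (_ : [set g | _] = [set g : BM | slice_hits cl (h *m (g : 'M[R]_(k + d)))]).
  by apply: measurable_slice_hits; apply: mx_measurableM => //; exact: mx_measurable_cst.
by apply/seteqP; split=> g /= /hE.
Qed.

Lemma prob_meets cl (p : {set 'I_(k + d)} * {set 'I_(k + d)}) : #|p.1| = k ->
  mu [set g : BM | meets_cube_face cl p.1 p.2 (rot g)] =
  mu [set g : BM | slice_hits cl (g : 'M[R]_(k + d))].
Proof.
move=> /(meets_rotated cl p.2)[h hO hE].
have mh : mx_measurable (fun g : BM => h *m (g : 'M[R]_(k + d))).
  by apply: mx_measurableM => //; exact: mx_measurable_cst.
rewrite -(haar_preimage haar hO (measurable_slice_hits cl mid) (measurable_slice_hits cl mh)).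
by congr (mu _); apply/seteqP; split=> g /= /hE.
Qed.

Lemma measurable_rotated :
  measurable_fun setT (rotated_std_subspace R (k + d) k :
    BM -> grassmann_space R (k + d) k).
Proof. by move=> _ B mB; rewrite setTI. Qed.

Definition rotated_mfun : {mfun BM >-> grassmann_space R (k + d) k} :=
  HB.pack (rotated_std_subspace R (k + d) k : BM -> grassmann_space R (k + d) k)
    (isMeasurableFun.Build _ _ _ _ _ measurable_rotated).

Local Notation G := (distribution mu rotated_mfun).

Lemma expected_facesE :
  expected_faces mu 0 k =
  (\int[G]_X counting (faces 0 (cube_section (X : {vspace 'cV[R]_(k + d)}))))%E.
Proof. by []. Qed.

Definition pattern_set cl (p : {set 'I_(k + d)} * {set 'I_(k + d)}) :
    set (grassmann_space R (k + d) k) :=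
  [set X | p \in patterns k /\ meets_cube_face cl p.1 p.2 (X : {vspace 'cV[R]_(k + d)})].

Lemma measurable_pattern_set cl p : measurable (pattern_set cl p).
Proof.
have [pk|pk] := boolP (p \in patterns k); last first.
  rewrite (_ : pattern_set cl p = set0); first exact: measurable0.
  by apply/seteqP; split=> X //= -[]; rewrite (negbTE pk).
rewrite (_ : pattern_set cl p = [set X : grassmann_space R (k + d) k |
    meets_cube_face cl p.1 p.2 (X : {vspace 'cV[R]_(k + d)})]); last first.
  by apply/seteqP; split=> X /=; [case|].
by move: pk; rewrite finset.in_set => /andP[/eqP pk _]; exact: measurable_meets.
Qed.

Lemma pattern_countE cl (X : grassmann_space R (k + d) k) :
  ((\sum_(p in patterns k)
      `[< meets_cube_face cl p.1 p.2 (X : {vspace 'cV[R]_(k + d)}) >])%N%:R%:E =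
  \sum_(p <- enum (patterns k)) (\1_(pattern_set cl p) X)%:E :> \bar R)%E.
Proof.
rewrite natr_sum -sumEFin -big_enum /=; apply: eq_big_seq => p; rewrite mem_enum => pk.
rewrite indicE; congr ((nat_of_bool _)%:R)%:E; apply/asboolP/idP; rewrite inE; first by [].
by case.
Qed.

Lemma measurable_pattern_count cl : measurable_fun setT (fun X : grassmann_space R (k + d) k =>
  ((\sum_(p in patterns k)
      `[< meets_cube_face cl p.1 p.2 (X : {vspace 'cV[R]_(k + d)}) >])%N%:R%:E : \bar R)).
Proof.
rewrite (_ : (fun _ => _) = fun X => (\sum_(p <- enum (patterns k)) (\1_(pattern_set cl p) X)%:E)%E).
  apply: emeasurable_sum => p; apply/measurable_EFinP; apply: measurable_indic.
  exact: measurable_pattern_set.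
by apply/funext => X; exact: pattern_countE.
Qed.

Lemma integral_patterns cl :
  (\int[G]_X (\sum_(p in patterns k)
      `[< meets_cube_face cl p.1 p.2 (X : {vspace 'cV[R]_(k + d)}) >])%N%:R%:E =
   (('C(k + d, k) * 2 ^ k)%N%:R)%:E * mu [set g : BM | slice_hits cl (g : 'M[R]_(k + d))])%E.
Proof.
under eq_integral do rewrite pattern_countE.
rewrite ge0_integral_sum//; last first.
  by move=> p; apply/measurable_EFinP; apply: measurable_indic; exact: measurable_pattern_set.
set q := mu _.
have qfin : q \is a fin_num by apply: fin_num_measure; exact: measurable_slice_hits.
transitivity (\sum_(p <- enum (@patterns (k + d) k)) (fine q)%:E)%E.
  apply: eq_big_seq => p; rewrite mem_enum => pk.
  rewrite integral_indic//; last exact: measurable_pattern_set.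
  rewrite setIT fineK// /q.
  have pk' : #|p.1| = k by move: pk; rewrite finset.in_set => /andP[/eqP].
  rewrite -(prob_meets cl pk'); congr (mu _).
  by apply/seteqP; split=> g /=; [case|].
rewrite sumEFin -(fineK qfin) -EFinM -card_patterns; congr EFin.
by rewrite big_enum sumr_const mulr_natl.
Qed.

(** By symmetry all the faces of codimension [k] are met with the same probability. *)
Lemma expected_faces_ge :
  ((('C(k + d, k) * 2 ^ k)%N%:R)%:E * mu [set g : BM | slice_hits false (g : 'M[R]_(k + d))] <=
   expected_faces mu 0 k)%E.
Proof.
rewrite -integral_patterns expected_facesE.
apply: integral_le_pointwise => X; first by rewrite lee_fin.
exact: count_vertices_ge.
Qed.

Lemma coord_transversal_rotated (J : {set 'I_(k + d)}) : #|J| = k ->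
  exists2 h, orthogonal_group R (k + d) h &
    forall g, coord_transversal J (rot g) <-> minor (h *m g) != 0.
Proof.
move=> /first_coords_perm[s ->].
have MO := @signed_perm_orthogonal R k d finset.set0 s.
exists (signed_perm finset.set0 s)^T; first exact: trmx_orthogonal.
move=> g; rewrite -transversal_first -(transversal_signed_perm finset.set0 first_coords s).
by rewrite mulmxA (mulmx1C MO) mul1mx.
Qed.

(** The subspaces of general position are the complement of this set; it is written as a
    finite union because its measure is estimated term by term. *)
Definition degenerate : set (grassmann_space R (k + d) k) :=
  \big[setU/set0]_(J <- enum {set 'I_(k + d)})
    [set X | #|J| = k /\ ~ coord_transversal J (X : {vspace 'cV[R]_(k + d)})].

Lemma degenerate_null : measurable degenerate /\ G degenerate = 0%E.
Proof.
rewrite /degenerate; elim/big_ind : _ => [|A A' [mA A0] [mA' A'0]|J _].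
- by split; [exact: measurable0|exact: measure0].
- by split; [exact: measurableU|exact: prob_null_setU].
have [Jk|Jk] := eqVneq #|J| k; last first.
  rewrite (_ : [set X | _] = set0); first by split; [exact: measurable0|exact: measure0].
  by apply/seteqP; split=> X //= -[/eqP]; rewrite (negbTE Jk).
have [h hO hE] := coord_transversal_rotated Jk.
have mh : mx_measurable (fun g : BM => h *m (g : 'M[R]_(k + d))).
  by apply: mx_measurableM => //; exact: mx_measurable_cst.
have E : rotated_mfun @^-1` [set X | #|J| = k /\ ~ coord_transversal J (X : {vspace 'cV[R]_(k + d)})] =
    [set g : BM | minor (h *m (g : 'M[R]_(k + d))) == 0].
  apply/seteqP; split=> g /=; first by move=> [_ /hE/negP]; rewrite negbK.
  by move=> g0; split=> // /hE; rewrite g0.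
have m0 (f : BM -> 'M[R]_(k + d)) : mx_measurable f -> measurable [set g : BM | minor (f g) == 0].
  by move=> mf; apply: measurable_set_bool; apply: measurable_fun_eqr => //; exact: measurable_minor.
split; first by rewrite /measurable /= E; exact: m0.
rewrite /distribution /pushforward E.
by rewrite (haar_preimage (A := [set g : BM | minor g == 0]) haar hO (m0 _ mid) (m0 _ mh)) minor_null.
Qed.

(** Adding the function equal to [+oo] on the null set of degenerate subspaces gives a
    measurable upper bound that holds everywhere. *)
Lemma expected_faces_le :
  (expected_faces mu 0 k <=
   (('C(k + d, k) * 2 ^ k)%N%:R)%:E * mu [set g : BM | slice_hits true (g : 'M[R]_(k + d))])%E.
Proof.
have [mD D0] := degenerate_null.
rewrite -integral_patterns expected_facesE.
set f := (X in (_ <= \int[_]_x X x)%E).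
have mf : measurable_fun setT f by exact: measurable_pattern_count.
have f0 X : (0 <= f X)%E by rewrite lee_fin.
have m1 : measurable_fun setT (fun X => (\1_degenerate X)%:E : \bar R).
  by apply/measurable_EFinP; exact: measurable_indic.
have mh : measurable_fun setT (fun X => (+oo * (\1_degenerate X)%:E)%E : \bar R).
  by apply: emeasurable_funM => //; exact: measurable_cst.
have h0 X : (0 <= +oo * (\1_degenerate X)%:E :> \bar R)%E.
  by rewrite mule_ge0// lee_fin.
have -> : (\int[G]_X f X = \int[G]_X (f X + +oo * (\1_degenerate X)%:E))%E.
  rewrite (ge0_integralD G measurableT (fun X _ => f0 X) mf (fun X _ => h0 X) mh).
  rewrite [X in (_ + X)%E](_ : _ = 0%E) ?adde0//.
  rewrite ge0_integralZl//.
  by rewrite integral_indic// setIT -[X in (_ * X)%E = _]/(G degenerate) D0 mule0.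
apply: integral_le_pointwise => X.
  by rewrite /counting; case: asboolP => // _; rewrite lee_fin.
have [XD|XD] := pselect (degenerate X).
  by rewrite indicE mem_set// mule1 addey// ?leey//.
rewrite indicE memNset// mule0 adde0; apply: count_vertices_le; first exact: leq_addr.
move=> J Jk; apply: contrapT => nt; apply: XD.
by rewrite /degenerate -bigcup_seq; exists J; rewrite /= ?mem_enum.
Qed.

End expected.

Theorem proposition2p5 (R : realType) (d n : nat)
    (mu : probability (borel_matrix R n) R) :
  (1 <= d)%N -> (d < n)%N -> normalized_haar mu ->
  (('C(n, d)%:R * 2 ^+ n *
      (1 / pi * atan (1 / Num.sqrt (n - d)%:R)) ^+ d)%:E
     <= expected_faces mu 0%N (n - d))%E /\
  (d = 1%N ->
   expected_faces mu 0%N (n - 1) =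
     (2 ^+ n * n%:R / pi * atan (1 / Num.sqrt (n - 1)%:R))%:E).
Proof.
move=> d1 dn.
have [k k0 nE] : exists2 k, (0 < k)%N & n = (k + d)%N.
  by exists (n - d)%N; [rewrite subn_gt0|rewrite subnK// ltnW].
case: d d1 dn nE => [//|m] _ _ nE; rewrite {n}nE in mu * => haar.
rewrite addnK; set a := atan (1 / Num.sqrt k%:R).
have lower : (('C(k + m.+1, m.+1)%:R * 2 ^+ (k + m.+1) * (1 / pi * a) ^+ m.+1)%:E <=
    expected_faces mu 0 k)%E.
  apply: le_trans (expected_faces_ge haar).
  apply: (@le_trans _ _ (('C(k + m.+1, k) * 2 ^ k)%N%:R%:E * ((2 / pi * a) ^+ m.+1)%:E)%E).
    rewrite -EFinM lee_fin -[in leRHS]bin_sub ?leq_addr// addKn.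
    have -> : 2 / pi * a = 2 * (1 / pi * a) by ring.
    move: (1 / pi * a) => b.
    by rewrite natrM natrX exprD exprMn !mulrA.
  by apply: lee_wpmul2l; [rewrite lee_fin|exact: slice_hits_ge].
split=> // m0; move: m0 lower haar => [m0]; subst m; rewrite addnK -/a => lower haar.
apply/eqP; rewrite eq_le; apply/andP; split.
  apply: le_trans (expected_faces_le haar) _.
  apply: (@le_trans _ _ (('C(k + 1, k) * 2 ^ k)%N%:R%:E * (2 / pi * a)%:E)%E).
    by apply: lee_wpmul2l; [rewrite lee_fin|exact: slice_hits_le].
  rewrite -EFinM lee_fin addn1 binSn natrM natrX exprS.
  by rewrite le_eqVlt; apply/orP; left; apply/eqP; ring.
apply: le_trans lower; rewrite lee_fin bin1 expr1 le_eqVlt; apply/orP; left; apply/eqP.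
by ring.
Qed.
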